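(* Let $0<\alpha<\beta<\infty$, $\mathcal{F}\subset\mathcal{F}_B^{[\alpha,\beta]}$ star-shaped with $L_2$-diameter $d$, $f\in\mathcal{F}$, $\epsilon\in(0,\tfrac13]$ with $k=1/(3\epsilon)$ an integer dividing $N$, and $\mathbf X$ the observed sample from $\tilde X_1,\dots,\tilde X_N$ i.i.d. with density $f$ after an arbitrary corruption of at most $\epsilon N$ observations. Let $c>0$ be a sufficiently large constant (chosen independently of the data), $C=\frac c2-1$, and $C_{10}$ as below. For $J\in\mathbb{N}$ let $\tau_J=\frac{\sqrt{C_{10}}\,d}{2^{J-1}(C+1)}$, and let $\bar J$ be the maximal $J\in\mathbb{N}$ with $$N\tau_J^2>\max\Big\{2\log\Big(\big[\mathcal{M}^{\mathrm{loc}}_{\mathcal{F}}\big(\tau_J\tfrac{c}{\sqrt{C_{10}}},2c\big)\big]^2\Big),\ \log2\Big\},$$ or $\bar J=1$ if no such $J$ exists. Let $\nu^*$ be the output of the multistage estimator below run with $\tilde J\ge\bar J$ levels. Then $$\mathbb{E}_f\|\nu^*-f\|_2^2\lesssim\max\{\tau_{\bar J}^2,\epsilon\}\wedge d^2 .$$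
   Context: $B\subseteq\mathbb{R}^p$ compact Borel with positive measure, $\mu$ a probability measure on $B$; $\mathcal{F}_B^{[\alpha,\beta]}$ the measurable $f:B\to[\alpha,\beta]$ with $\int_Bf\,d\mu=1$; $\|f-g\|_2=(\int_B(f-g)^2d\mu)^{1/2}$; $B_2(q,r)$ the closed $L_2$ ball; $\mathcal{F}$ star-shaped (some $f_0\in\mathcal{F}$ with $tf+(1-t)f_0\in\mathcal{F}$ for $f\in\mathcal{F},t\in[0,1]$). An $\eta$-packing of $S$ is a subset of $S$ with pairwise distances $>\eta$; $\mathcal{M}(\eta,S)$ is the maximal cardinality of such a set; local metric entropy: $\mathcal{M}^{\mathrm{loc}}_{\mathcal{F}}(\tau,c')=\sup_{g\in\mathcal{F}}\mathcal{M}(\tau/c',\mathcal{F}\cap B_2(g,\tau))$. Constants: $h(\gamma)=\frac{\gamma-1-\log\gamma}{(\gamma-1)^2}$ ($\gamma\ne1$), $h(1)=\frac12$, $c(\alpha,\beta)=h(\beta/\alpha)/\beta$, $K=\beta/(\alpha^2c(\alpha,\beta))$, $L(\alpha,\beta,C)=\frac{\{\sqrt{c(\alpha,\beta)}(C-1)-\sqrt{1/\alpha}\}^2}{2(2K+\frac23\log(\beta/\alpha))}$ with $C>1+\sqrt{1/(\alpha c(\alpha,\beta))}$, and $C_{10}=\frac{L(\alpha,\beta,C)}{4}(\frac12-\frac\phi3)$ for a fixed $\phi\in(1,\frac32)$. Comparison: with a fixed partition $G_1,\dots,G_{N/k}$ of $\{1,\dots,N\}$ into groups of size $k$, $\psi(g,g',\mathbf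 X)=\mathbb{1}\big(\sum_{j}\mathbb{1}(\sum_{i\in G_j}\log\frac{g(X_i)}{g'(X_i)}>0)\ge\frac N{2k}\big)$, and $g'\prec g$ means $\psi(g,g',\mathbf X)=1$. Selection rule on a finite set $\{u_1,\dots,u_M\}$ at scale $\delta$: $E_i=\{j:u_i\prec u_j,\|u_i-u_j\|_2\ge C\delta\}$, $T_i=\max_{j\in E_i}\|u_i-u_j\|_2$ (or $0$ if $E_i=\emptyset$), select $u_{i^*}$ with $i^*\in\operatorname{argmin}_iT_i$. Estimator (tree built before seeing data): pick an arbitrary root $\nu_1\in\mathcal{F}$, level $\mathcal{L}(1)=\{\nu_1\}$. Level 2: the offspring of $\nu_1$ form a maximal $d/c$-packing of $\mathcal{F}$. For $3\le j\le\tilde J$: for each $q\in\mathcal{L}(j-1)$ take a maximal $\frac{d}{2^{j-1}c}$-packing of $B_2(q,d/2^{j-2})\cap\mathcal{F}$ as candidate offspring of $q$; list all candidates in a fixed order and, while the list is nonempty, take its first element $q_l$, let $T$ be the other listed candidates within distance $\frac{d}{2^{j-1}c}$ of $q_l$, replace each member of $T$ among its parent's offspring by $q_l$, and remove $q_l$ and $T$ from the list; $\mathcal{L}(j)$ is the union of the resulting offspring sets. Then, using the data, for $j=2,\dots,\tilde J$ set $\nu_j$ to be the element of the offspring set of $\nu_{j-1}$ chosen by the selection rule at scale $\delta_j=\frac{d}{2^{j-2}c}$; output $\nu^*=\nu_{\tilde J}$. $\lesssim$ hides a positive constant independent of $N$, $\epsilon$, $f$ and the corruption. *)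

(* Defs.v *)
From HB Require Import structures.
From mathcomp Require Import all_boot all_order all_algebra.
From mathcomp Require Import all_classical all_reals all_analysis.
Set Implicit Arguments. Unset Strict Implicit. Unset Printing Implicit Defensive.
Import Order.TTheory GRing.Theory Num.Theory.
Local Open Scope classical_set_scope.
Local Open Scope ring_scope.

Section Defs.
Context {R : realType} {dT : measure_display} {T : measurableType dT}.
Variable mu : {measure set T -> \bar R}.

Definition dist2 (g h : T -> R) : R :=
  Num.sqrt (fine (\int[mu]_x (((g x - h x) ^+ 2)%:E))).

Definition ball2 (q : T -> R) (r : R) : set (T -> R) := [set h | dist2 q h <= r].

Definition in_class (alpha beta : R) (g : T -> R) : Prop :=
  [/\ measurable_fun setT g, (forall x, alpha <= g x <= beta)
    & (\int[mu]_x (g x)%:E = 1)%E].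

Definition star_shaped (F : set (T -> R)) : Prop :=
  exists f0, F f0 /\ forall g, F g -> forall t : R, 0 <= t <= 1 ->
    F (fun x => t * g x + (1 - t) * f0 x).

Definition diameter (F : set (T -> R)) : R :=
  sup [set dist2 g h | g in F & h in F].

Definition nth0 (P : seq (T -> R)) (i : nat) : T -> R := nth (fun _ => 0) P i.

Definition inl (u : T -> R) (P : seq (T -> R)) : Prop :=
  exists2 i, (i < size P)%N & nth0 P i = u.

Definition is_packing (eta : R) (S : set (T -> R)) (P : seq (T -> R)) : Prop :=
  (forall u, inl u P -> S u) /\
  (forall i j, (i < size P)%N -> (j < size P)%N -> i <> j ->
     eta < dist2 (nth0 P i) (nth0 P j)).

Definition maximal_packing (eta : R) (S : set (T -> R)) (P : seq (T -> R)) : Prop :=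
  is_packing eta S P /\
  ~ (exists g, S g /\ forall u, inl u P -> eta < dist2 g u).

Definition packing_number (eta : R) (S : set (T -> R)) : \bar R :=
  ereal_sup [set ((size P)%:R)%:E | P in [set P | is_packing eta S P]].

Definition local_entropy (F : set (T -> R)) (tau c' : R) : \bar R :=
  ereal_sup [set packing_number (tau / c') (F `&` ball2 g tau) | g in F].

End Defs.

Section Constants.
Context {R : realType}.
Definition hfun (g : R) : R :=
  if g == 1 then 2^-1 else (g - 1 - ln g) / (g - 1) ^+ 2.
Definition cab (alpha beta : R) : R := hfun (beta / alpha) / beta.
Definition Kab (alpha beta : R) : R := beta / (alpha ^+ 2 * cab alpha beta).
Definition Lab (alpha beta C : R) : R :=
  (Num.sqrt (cab alpha beta) * (C - 1) - Num.sqrt (alpha^-1)) ^+ 2 /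
  (2 * (2 * Kab alpha beta + 2 / 3 * ln (beta / alpha))).
Definition C10 (alpha beta C phi : R) : R := Lab alpha beta C / 4 * (2^-1 - phi / 3).
Definition Cof (c : R) : R := c / 2 - 1.
Definition tauJ (alpha beta phi c d : R) (J : nat) : R :=
  Num.sqrt (C10 alpha beta (Cof c) phi) * d / (2 ^+ J.-1 * (Cof c + 1)).
End Constants.

Section Jbar.
Context {R : realType} {dT : measure_display} {T : measurableType dT}.
Variable mu : {measure set T -> \bar R}.

Definition Jcond (F : set (T -> R)) (alpha beta phi c d : R) (N J : nat) : Prop :=
  let tau := tauJ alpha beta phi c d J in
  exists m : nat,
    local_entropy mu F (tau * c / Num.sqrt (C10 alpha beta (Cof c) phi)) (2 * c)
      = (m%:R)%:E /\
    Num.max (2 * ln ((m%:R) ^+ 2)) (ln 2) < N%:R * tau ^+ 2.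

Definition is_Jbar (F : set (T -> R)) (alpha beta phi c d : R) (N Jb : nat) : Prop :=
  (1 <= Jb)%N /\
  ((Jcond F alpha beta phi c d N Jb /\
      forall J, (Jb < J)%N -> ~ Jcond F alpha beta phi c d N J)
   \/ ((forall J, (1 <= J)%N -> ~ Jcond F alpha beta phi c d N J) /\ Jb = 1%N)).

(* merging step at level j with threshold eta; entries are (parent, candidate) *)
Fixpoint merge_aux (eta : R) (n : nat) (l : seq ((T -> R) * (T -> R)))
  {struct n} : seq ((T -> R) * (T -> R)) :=
  match n with
  | O => l
  | S n' =>
    match l with
    | [::] => [::]
    | x :: rest =>
      x :: [seq (y.1, x.2) | y <- rest & dist2 mu y.2 x.2 <= eta]
        ++ merge_aux eta n' [seq y <- rest | ~~ (dist2 mu y.2 x.2 <= eta)]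
    end
  end.
Definition merge (eta : R) l := merge_aux eta (size l) l.

(* pk j q : the chosen maximal packing (candidate offspring of q) at level j *)
Definition candidates (pk : nat -> (T -> R) -> seq (T -> R)) (j : nat)
  (L : seq (T -> R)) : seq ((T -> R) * (T -> R)) :=
  flatten [seq [seq (q, u) | u <- pk j q] | q <- L].

Definition merge_eta (d c : R) (j : nat) : R := d / (2 ^+ j.-1 * c).

Fixpoint level (pk : nat -> (T -> R) -> seq (T -> R)) (root : T -> R) (d c : R)
  (j : nat) : seq (T -> R) :=
  match j with
  | O => [::]
  | S O => [:: root]
  | S (S O) => pk 2%N root
  | S ((S (S _)) as j1) =>
      [seq y.2 | y <- merge (merge_eta d c j1.+1)
                        (candidates pk j1.+1 (level pk root d c j1))]
  end.

Definition offspring (pk : nat -> (T -> R) -> seq (T -> R)) (root : T -> R) (d c : R)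
  (j : nat) (q : T -> R) : seq (T -> R) :=
  if j == 2%N then pk 2%N q
  else [seq y.2 | y <- merge (merge_eta d c j)
                        (candidates pk j (level pk root d c j.-1)) & `[< y.1 = q >]].

Definition tree_ok (F : set (T -> R)) (pk : nat -> (T -> R) -> seq (T -> R))
  (root : T -> R) (d c : R) (Jt : nat) : Prop :=
  maximal_packing mu (d / c) F (pk 2%N root) /\
  forall j, (3 <= j <= Jt)%N -> forall q, inl q (level pk root d c j.-1) ->
    maximal_packing mu (d / (2 ^+ j.-1 * c)) (ball2 mu q (d / 2 ^+ (j - 2)) `&` F) (pk j q).

Definition psi (N k : nat) (grp : 'I_N -> 'I_(N %/ k)) (g g' : T -> R)
  (X : 'I_N -> T) : bool :=
  (N%:R / (2 * k%:R) : R) <=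
  (#|[set j : 'I_(N %/ k) | 0 < \sum_(i < N | grp i == j) ln (g (X i) / g' (X i))]%SET|)%:R.

(* T_i for u = u_i : max distance over E_i (0 if empty); u_i < u_j iff psi(u_j,u_i,X) *)
Definition Tsel (N k : nat) (grp : 'I_N -> 'I_(N %/ k)) (C delta : R)
  (X : 'I_N -> T) (S : seq (T -> R)) (u : T -> R) : R :=
  \big[Num.max/0]_(v <- S | psi grp v u X && (C * delta <= dist2 mu u v)) dist2 mu u v.

Definition selected (N k : nat) (grp : 'I_N -> 'I_(N %/ k)) (C delta : R)
  (X : 'I_N -> T) (S : seq (T -> R)) (u : T -> R) : Prop :=
  inl u S /\ forall v, inl v S -> Tsel grp C delta X S u <= Tsel grp C delta X S v.

End Jbar.

Definition iid_density {R : realType} {dT : measure_display} {T : measurableType dT}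
  {dO : measure_display} {O : measurableType dO}
  (mu : {measure set T -> \bar R}) (P : probability O R) (N : nat)
  (Xt : 'I_N -> O -> T) (f : T -> R) : Prop :=
  (forall i (A : set T), measurable A ->
     P (Xt i @^-1` A) = (\int[mu]_(x in A) (f x)%:E)%E) /\
  (forall A : 'I_N -> set T, (forall i, measurable (A i)) ->
     P [set w | forall i, A i (Xt i w)] = (\prod_(i < N) P (Xt i @^-1` A i))%E).

(* Main.v *)
Require Import Defs.
From HB Require Import structures.
From mathcomp Require Import all_boot all_order all_algebra.
From mathcomp Require Import all_classical all_reals all_analysis.
From mathcomp Require Import measurable_realfun.
From mathcomp Require Import ring lra zify.
Import Order.TTheory GRing.Theory Num.Theory.
Local Open Scope classical_set_scope.
Local Open Scope ring_scope.

Set Implicit Arguments.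
Unset Strict Implicit.
Unset Printing Implicit Defensive.

(** A comparison of [u], close to the truth [f], with a distant [v] fails only if at
    least [N / (6 k)] groups of the uncorrupted sample have nonnegative
    log-likelihood ratio sum for [v] against [u], since the corruption touches at
    most [N / (3 k)] groups. A union bound over sets of groups reduces this to the
    exponential moment of order 1/2: [int f sqrt(v / u)] is at most
    [1 - 3 |u - v|^2 / (32 beta)], by the Hellinger distance of [u] and [v] and
    AM-GM for the error [f - u]. Hence one comparison at scale [delta_j] fails with
    probability at most [exp (- N tau_j^2)] as soon as [tau_j^2 >= 3 eps].

    Merging makes the nodes of a level separated, so the number of nodes near [f]
    and the number of offspring of a node are bounded by the local entropy, which
    is monotone because [F] is star-shaped. Level [j] then loses [f] with
    probability at most [exp (- N tau_j^2 / 2)], and a loss at level [j] costs at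
    most [25 (d / 2 ^ (j - 2))^2] since later levels move the estimate by a
    geometrically decreasing amount. Summing over the levels up to the last [J]
    with [tau_J^2 >= 3 eps] gives the bound. *)

(** * The L2 distance on bounded measurable functions *)

Section L2Distance.
Context {R : realType} {dT : measure_display} {T : measurableType dT}.
Variable mu : probability T R.

(** A class closed under sums and products and integrable for a probability, so that [Rintegral] is
    linear and monotone on it. Densities with values in [[alpha, beta]] belong to it. *)
Definition bounded_measurable (g : T -> R) : Prop :=
  measurable_fun setT g /\ exists M : R, forall x, `|g x| <= M.

Local Notation bm := bounded_measurable.

Lemma bm_integrable g : bm g -> mu.-integrable setT (EFin \o g).
Proof.
move=> [mg [M gM]]; apply: measurable_bounded_integrable => //.

  by apply: (@le_lt_trans _ _ 1%E); [exact: probability_le1|exact: ltry].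
exists M; split; first exact: num_real.
by move=> B MB x _ /=; exact: le_trans (gM x) (ltW MB).
Qed.

Lemma bm_cst (r : R) : bm (fun=> r).
Proof. by split; [exact: measurable_cst | exists `|r|]. Qed.

Lemma bmD g h : bm g -> bm h -> bm (fun x => g x + h x).
Proof.
move=> [mg [M gM]] [mh [M' hM]]; split; first exact: measurable_funD.
by exists (M + M') => x; rewrite (le_trans (ler_normD _ _)) ?lerD.
Qed.

Lemma bmM g h : bm g -> bm h -> bm (fun x => g x * h x).
Proof.
move=> [mg [M gM]] [mh [M' hM]]; split; first exact: measurable_funM.
by exists (M * M') => x; rewrite normrM ler_pM.
Qed.

Lemma bmB g h : bm g -> bm h -> bm (fun x => g x - h x).
Proof.
move=> bg bh; have := bmD bg (bmM (bm_cst (-1)) bh).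
by congr bm; apply/funext => x; rewrite mulN1r.
Qed.

Lemma bm_sqrB g h : bm g -> bm h -> bm (fun x => (g x - h x) ^+ 2).
Proof.
move=> bg bh; have := bmM (bmB bg bh) (bmB bg bh).
by congr bm; apply/funext => x; rewrite expr2.
Qed.

Lemma RintegralD_bm g h : bm g -> bm h ->
  \int[mu]_x (g x + h x) = \int[mu]_x g x + \int[mu]_x h x.
Proof. by move=> /bm_integrable ig /bm_integrable ih; rewrite RintegralD. Qed.

Lemma RintegralB_bm g h : bm g -> bm h ->
  \int[mu]_x (g x - h x) = \int[mu]_x g x - \int[mu]_x h x.
Proof. by move=> /bm_integrable ig /bm_integrable ih; rewrite RintegralB. Qed.

Lemma RintegralZ_bm r g : bm g ->
  \int[mu]_x (r * g x) = r * \int[mu]_x g x.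
Proof. by move=> /bm_integrable ig; rewrite RintegralZl. Qed.

Lemma le_Rintegral_bm g h : bm g -> bm h -> (forall x, g x <= h x) ->
  \int[mu]_x g x <= \int[mu]_x h x.
Proof.
by move=> /bm_integrable ig /bm_integrable ih gh; apply: le_Rintegral.
Qed.

Lemma Rintegral_cst_prob (r : R) : \int[mu]_x r = r.
Proof.
have mu1 : fine (mu setT) = 1 by rewrite probability_setT.
by rewrite Rintegral_cst// (mu1 : fine ((mu : {measure set T -> \bar R}) setT) = 1) mulr1.
Qed.

Lemma integral_bm g : bm g -> (\int[mu]_x (g x)%:E)%E = (\int[mu]_x g x)%:E.
Proof.
move=> bg; rewrite /Rintegral fineK//.
by apply: integrable_fin_num => //; exact: bm_integrable bg.
Qed.

Lemma dist2_ge0 g h : 0 <= dist2 mu g h.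
Proof. exact: sqrtr_ge0. Qed.

Lemma dist2_sqr g h : dist2 mu g h ^+ 2 = \int[mu]_x (g x - h x) ^+ 2.
Proof.
by rewrite sqr_sqrtr//; apply: Rintegral_ge0 => x _; exact: sqr_ge0.
Qed.

Lemma dist2C g h : dist2 mu g h = dist2 mu h g.
Proof.
rewrite /dist2; congr (Num.sqrt (fine _)); apply: eq_integral => x _.
by rewrite -sqrrN opprB.
Qed.

Lemma dist2xx g : dist2 mu g g = 0.
Proof.
rewrite /dist2 (eq_integral (fun=> 0%E)) ?integral0 ?sqrtr0//.
by move=> x _; rewrite subrr expr0n.
Qed.

(* Choose l = (b + e) / (a + e) and let e tend to 0. *)
Lemma sqrD_ge_of_weights (a b X : R) : 0 <= a -> 0 <= b ->
  (forall l, 0 < l -> X <= (1 + l) * a ^+ 2 + (1 + l^-1) * b ^+ 2) ->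
  X <= (a + b) ^+ 2.
Proof.
move=> a0 b0 H; apply/ler_addgt0Pr => e e0.
(* The shift keeps both denominators positive even if [a] or [b] vanishes, and its total cost
   [2 s (a + b)] is at most [e]. *)
pose s := e / (2 * (a + b) + 1).
have s0 : 0 < s by rewrite divr_gt0//; lra.
have l0 : 0 < (b + s) / (a + s) by rewrite divr_gt0//; lra.
apply: le_trans (H _ l0) _.
have se : s * (2 * (a + b)) <= e.
  rewrite /s -mulrA ler_piMr ?(ltW e0)// mulrC ler_pdivrMr; lra.
have as0 : a + s != 0 by rewrite gt_eqF//; lra.
have bs0 : b + s != 0 by rewrite gt_eqF//; lra.
have -> : (1 + (b + s) / (a + s)) * a ^+ 2 = (a + b + 2 * s) * a * (a / (a + s)).
  by field.
have -> : (1 + ((b + s) / (a + s))^-1) * b ^+ 2 =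
    (a + b + 2 * s) * b * (b / (b + s)) by field; rewrite as0 bs0.
have qa : a / (a + s) <= 1 by rewrite ler_pdivrMr; lra.
have qb : b / (b + s) <= 1 by rewrite ler_pdivrMr; lra.
have ha : (a + b + 2 * s) * a * (a / (a + s)) <= (a + b + 2 * s) * a.
  by rewrite ler_piMr// mulr_ge0//; lra.
have hb : (a + b + 2 * s) * b * (b / (b + s)) <= (a + b + 2 * s) * b.
  by rewrite ler_piMr// mulr_ge0//; lra.
nra.
Qed.

Lemma sqrD_le_weights (l a b : R) : 0 < l ->
  (a + b) ^+ 2 <= (1 + l) * a ^+ 2 + (1 + l^-1) * b ^+ 2.
Proof.
move=> l0; rewrite -subr_ge0.
have -> : (1 + l) * a ^+ 2 + (1 + l^-1) * b ^+ 2 - (a + b) ^+ 2 =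
  l^-1 * (l * a - b) ^+ 2 by field; rewrite gt_eqF.
by rewrite mulr_ge0 ?sqr_ge0// invr_ge0 ltW.
Qed.

(** The weighted inequality [sqrD_le_weights] is integrated for each fixed weight, and the weight is
    optimised afterwards on the norms. *)
Lemma dist2_triangle g h k : bm g -> bm h -> bm k ->
  dist2 mu g k <= dist2 mu g h + dist2 mu h k.
Proof.
move=> bg bh bk.
rewrite -(@ler_pXn2r R 2)// ?nnegrE ?addr_ge0 ?dist2_ge0//.
apply: sqrD_ge_of_weights; rewrite ?dist2_ge0// => l l0.
rewrite !dist2_sqr -!RintegralZ_bm; try exact: bm_sqrB.
rewrite -RintegralD_bm; try by apply: bmM; [exact: bm_cst|exact: bm_sqrB].
apply: le_Rintegral_bm; first exact: bm_sqrB.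
  by apply: bmD; apply: bmM; (exact: bm_cst || exact: bm_sqrB).
move=> x; rewrite -[g x - k x](_ : (g x - h x) + (h x - k x) = _).
  exact: sqrD_le_weights.
by ring.
Qed.

Lemma dist2_le_cst g h (M : R) : bm g -> bm h -> 0 <= M ->
  (forall x, `|g x - h x| <= M) -> dist2 mu g h <= M.
Proof.
move=> bg bh M0 ghM.
rewrite -(@ler_pXn2r R 2)// ?nnegrE ?dist2_ge0// dist2_sqr.
rewrite -(Rintegral_cst_prob (M ^+ 2)).
apply: le_Rintegral_bm; [exact: bm_sqrB|exact: bm_cst|move=> x].
by rewrite -real_normK ?num_real// lerXn2r ?nnegrE.
Qed.

(** The homothety towards the star centre scales distances exactly; this is what transports packings
    from one scale to a smaller one. *)
Lemma dist2_contract (t : R) (f0 g h : T -> R) : 0 <= t -> bm g -> bm h ->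
  dist2 mu (fun x => t * g x + (1 - t) * f0 x)
           (fun x => t * h x + (1 - t) * f0 x) = t * dist2 mu g h.
Proof.
move=> t0 bg bh; apply/eqP.
rewrite -(@eqrXn2 R 2)// ?mulr_ge0 ?dist2_ge0// exprMn !dist2_sqr.
rewrite -RintegralZ_bm; last exact: bm_sqrB.
by apply/eqP; apply: eq_Rintegral => x _; ring.
Qed.

Lemma in_class_bm (a b : R) g : 0 < a -> in_class mu a b g -> bm g.
Proof.
move=> a0 [mg gab _]; split => //; exists b => x.
by have /andP[ag gb] := gab x; rewrite ger0_norm//; lra.
Qed.

Lemma in_class_Rintegral (a b : R) g : in_class mu a b g -> \int[mu]_x g x = 1.
Proof. by move=> [_ _ ig]; rewrite /Rintegral ig. Qed.

End L2Distance.

(** * Bounds on the constants [h], [c(alpha, beta)] and [L] *)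

Section ConstantBounds.
Context {R : realType}.

Lemma ln_le_subr1 (y : R) : 0 < y -> ln y <= y - 1.
Proof.
move=> y0; rewrite -[X in ln X](_ : 1 + (y - 1) = y); last by ring.
by apply: le_ln1Dx; lra.
Qed.

(** With [s = sqrt y], write [ln y = 2 ln s] and use [1 - 1 / s <= ln s <= s - 1]. The right
    inequality leaves the numerator at least [(s - 1) ^ 2]; the left one gives the upper bound after
    factoring out [(s - 1) ^ 2]. *)
Lemma hfun_bounds (y : R) : 1 < y -> 0 < hfun y <= 3 / 4.
Proof.
move=> y1; rewrite /hfun gt_eqF//.
have y0 : 0 < y by lra.
pose s := Num.sqrt y.
have s1 : 1 < s by rewrite -sqrtr1 ltr_sqrt.
have sy : s ^+ 2 = y by rewrite sqr_sqrtr// ltW.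
have lny : ln y = 2 * ln s by rewrite -sy lnXn ?mulr_natl//; lra.
have lnU := ln_le_subr1 (_ : 0 < s).
have lnL : 1 - s^-1 <= ln s.
  have := ln_le_subr1 (_ : 0 < s^-1).
  by rewrite lnV ?posrE ?invr_gt0; lra.
have {}lnU : ln s <= s - 1 by apply: lnU; lra.
have y10 : 0 < (y - 1) ^+ 2 by rewrite exprn_gt0//; lra.
apply/andP; split; first by rewrite divr_gt0// lny -sy; nra.
rewrite ler_pdivrMr// lny -sy.
have sV : s * s^-1 = 1 by rewrite divff//; lra.
have sV0 : 0 < s^-1 by rewrite invr_gt0; lra.
have sV1 : s^-1 < 1 by rewrite invf_lt1; lra.
apply: (@le_trans _ _ (s ^+ 2 - 1 - 2 * (1 - s^-1))); first lra.
rewrite -subr_ge0.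
have -> : 3 / 4 * (s ^+ 2 - 1) ^+ 2 - (s ^+ 2 - 1 - 2 * (1 - s^-1)) =
  (s - 1) ^+ 2 * (3 / 4 * (s + 1) ^+ 2 - 1 - 2 * s^-1)
  by field; lra.
by apply: mulr_ge0; [exact: sqr_ge0 | nra].
Qed.

Lemma cab_bounds (a b : R) : 0 < a -> a < b -> 0 < cab a b <= 3 / 4 / b.
Proof.
move=> a0 ab; have b0 : 0 < b by lra.
have /hfun_bounds/andP[h0 h1] : 1 < b / a by rewrite ltr_pdivlMr; lra.
by rewrite /cab divr_gt0//= ler_pM2r ?invr_gt0.
Qed.

(** The condition on [C] says that the base of the squared numerator is positive. For the upper
    bound the logarithm is dropped from the denominator, leaving
    [(cab a b * a) ^ 2 / (4 b) * C ^ 2], where [cab a b * a <= 3 / 4]. *)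
Lemma Lab_bounds (a b C : R) : 0 < a -> a < b ->
  1 + Num.sqrt ((a * cab a b)^-1) < C ->
  0 < Lab a b C <= 9 / 64 / b * C ^+ 2.
Proof.
move=> a0 ab C1; have b0 : 0 < b by lra.
have /andP[h0 h1] := cab_bounds a0 ab.
have C1' : 1 < C by have := sqrtr_ge0 ((a * cab a b)^-1); lra.
set X := Num.sqrt (cab a b) * (C - 1) - Num.sqrt a^-1.
have s0 : 0 < Num.sqrt (cab a b) by rewrite sqrtr_gt0.
have X0 : 0 < X.
  rewrite subr_gt0.
  have -> : Num.sqrt a^-1 = Num.sqrt (cab a b) * Num.sqrt ((a * cab a b)^-1).
    by rewrite -sqrtrM ?(ltW h0)//; congr Num.sqrt; field; lra.
  by rewrite ltr_pM2l//; lra.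
have X1 : X <= Num.sqrt (cab a b) * (C - 1) by rewrite gerBl sqrtr_ge0.
have X2 : X ^+ 2 <= cab a b * C ^+ 2.
  apply: (@le_trans _ _ (cab a b * (C - 1) ^+ 2)).
    by rewrite -[in leRHS](sqr_sqrtr (ltW h0)) -exprMn lerXn2r ?nnegrE//; lra.
  by rewrite ler_pM2l// lerXn2r ?nnegrE; lra.
have K0 : 0 < Kab a b by rewrite divr_gt0// mulr_gt0// exprn_gt0.
have l0 : 0 < ln (b / a) by rewrite ln_gt0// ltr_pdivlMr; lra.
rewrite /Lab -/X; apply/andP; split.
  by rewrite divr_gt0 ?exprn_gt0//; lra.
apply: (@le_trans _ _ (cab a b * C ^+ 2 / (4 * Kab a b))).
  by apply: ler_pM => //; rewrite ?sqr_ge0 ?invr_ge0 ?lef_pV2 ?posrE; lra.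
have -> : cab a b * C ^+ 2 / (4 * Kab a b) =
  (cab a b * a) ^+ 2 / (4 * b) * C ^+ 2.
  by rewrite /Kab; field; rewrite !gt_eqF.
apply: ler_wpM2r; first exact: sqr_ge0.
rewrite ler_pdivrMr; last lra.
have -> : 9 / 64 / b * (4 * b) = (3 / 4) ^+ 2 :> R by field; rewrite gt_eqF.
apply: lerXn2r; rewrite ?nnegrE; [by rewrite mulr_ge0//; lra|lra|].
apply: (@le_trans _ _ (cab a b * b)); first by rewrite ler_pM2l// ltW.
by rewrite -ler_pdivlMr.
Qed.

End ConstantBounds.

(** * Exponential moment of order 1/2 under a misspecified density *)

Section Affinity.
Context {R : realType}.

(* With [s^2 = g], [t^2 = g']:
   [f s / t = s t + (f - t^2) (s / t - 1) + (f - t^2)]. *)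
Lemma affinity_pointwise (a b C f g g' : R) : 0 < a -> 0 < C ->
  a <= g <= b -> a <= g' <= b ->
  f * Num.sqrt (g / g') <= 2^-1 * g + (f - 2^-1 * g')
    + ((4 * a * C)^-1 - (8 * b)^-1) * (g - g') ^+ 2
    + C / (4 * a) * (g' - f) ^+ 2.
Proof.
move=> a0 C0 /andP[ag gb] /andP[ag' gb'].
have b0 : 0 < b by lra.
rewrite sqrtrM ?sqrtrV; [|lra..].
have s0 : 0 < Num.sqrt g by rewrite sqrtr_gt0; lra.
have t0 : 0 < Num.sqrt g' by rewrite sqrtr_gt0; lra.
have sg : Num.sqrt g ^+ 2 = g by rewrite sqr_sqrtr; lra.
have tg : Num.sqrt g' ^+ 2 = g' by rewrite sqr_sqrtr; lra.
move: (Num.sqrt g) (Num.sqrt g') s0 t0 sg tg => s t s0 t0 sg tg.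
have sta : a <= s * t.
  rewrite -(@ler_pXn2r _ 2) ?nnegrE; [|by []|lra|by rewrite mulr_ge0 ?ltW].
  by rewrite exprMn sg tg expr2; apply: ler_pM; lra.
(* The deficit of [s t] against the mean is [(s - t) ^ 2 / 2], and
   [(g - g') ^ 2 = (s - t) ^ 2 (s + t) ^ 2] with [(s + t) ^ 2 <= 4 b]. *)
have H1 : s * t <= 2^-1 * (g + g') - (8 * b)^-1 * (g - g') ^+ 2.
  have : (8 * b)^-1 * (g - g') ^+ 2 <= 2^-1 * (s - t) ^+ 2.
    rewrite mulrC ler_pdivrMr; last lra.
    have -> : (g - g') ^+ 2 = (s - t) ^+ 2 * (s + t) ^+ 2 by rewrite -sg -tg; ring.
    have -> : 2^-1 * (s - t) ^+ 2 * (8 * b) = (s - t) ^+ 2 * (4 * b) by field.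
    by apply: ler_wpM2l; [exact: sqr_ge0|nra].
  by rewrite -sg -tg; lra.
set q := s / t - 1.
have H2 : (f - g') * q <= C / (4 * a) * (g' - f) ^+ 2 + a / C * q ^+ 2.
  rewrite -subr_ge0.
  have -> : C / (4 * a) * (g' - f) ^+ 2 + a / C * q ^+ 2 - (f - g') * q =
    (C * (f - g') - 2 * a * q) ^+ 2 / (4 * a * C) by field; rewrite !gt_eqF.
  by rewrite divr_ge0 ?sqr_ge0// !mulr_ge0//; lra.
(* Here [g - g' = t (s + t) q], and [t (s + t) = t ^ 2 + s t >= 2 a]. *)
have H3 : a / C * q ^+ 2 <= (4 * a * C)^-1 * (g - g') ^+ 2.
  have -> : a / C * q ^+ 2 = (4 * a * C)^-1 * (2 * a * q) ^+ 2.
    by field; rewrite !gt_eqF.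
  apply: ler_wpM2l; first by rewrite invr_ge0 !mulr_ge0//; lra.
  have -> : g - g' = (t * (s + t)) * q.
    by rewrite /q -sg -tg; field; rewrite gt_eqF.
  rewrite [(2 * a * q) ^+ 2]exprMn [(t * (s + t) * q) ^+ 2]exprMn.
  apply: ler_wpM2r; first exact: sqr_ge0.
  apply: lerXn2r; rewrite ?nnegrE; [lra|nra|].
  by have : t ^+ 2 = t * t; [exact: expr2|nra].
have -> : f * (s / t) = s * t + (f - g') * q + (f - g').
  by rewrite /q -tg; field; rewrite gt_eqF.
by rewrite mulrBl; lra.
Qed.

Context {dT : measure_display} {T : measurableType dT}.
Variable mu : probability T R.

Lemma sqrt_ratio_expR (x y : R) : 0 < x -> 0 < y ->
  Num.sqrt (x / y) = expR (2^-1 * ln (x / y)).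
Proof.
move=> x0 y0; have xy0 : 0 < x / y by rewrite divr_gt0.
apply/eqP; rewrite -(@eqrXn2 _ 2) ?sqrtr_ge0 ?expR_ge0// sqr_sqrtr ?ltW//.
by rewrite -expRM_natl mulrA divff// mul1r lnK.
Qed.

Lemma measurable_sqrt_ratio (g g' : T -> R) :
  measurable_fun setT g -> measurable_fun setT g' ->
  (forall x, 0 < g x) -> (forall x, 0 < g' x) ->
  measurable_fun setT (fun x => Num.sqrt (g x / g' x)).
Proof.
move=> mg mg' g0 g'0.
rewrite (_ : (fun x => _) = (fun x => expR (2^-1 * (ln (g x) - ln (g' x))))).
  apply: (measurableT_comp (@measurable_expR R)).
  apply: measurable_funM => //; apply: measurable_funB.
    exact: (measurableT_comp (@measurable_ln R)).
  exact: (measurableT_comp (@measurable_ln R)).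
by apply/funext => x; rewrite sqrt_ratio_expR// ln_div ?posrE.
Qed.

Lemma bm_sqrt_ratio (a b : R) (g g' : T -> R) : 0 < a ->
  in_class mu a b g -> in_class mu a b g' ->
  bounded_measurable (fun x => Num.sqrt (g x / g' x)).
Proof.
move=> a0 [mg gab _] [mg' gab' _].
split.
  apply: measurable_sqrt_ratio => // x.
    by have /andP[ag _] := gab x; lra.
  by have /andP[ag _] := gab' x; lra.
exists (Num.sqrt (b / a)) => x; rewrite ger0_norm ?sqrtr_ge0// ler_wsqrtr//.
have /andP[ag gb] := gab x; have /andP[ag' gb'] := gab' x.
by apply: ler_pM; rewrite ?invr_ge0 ?lef_pV2 ?posrE//; lra.
Qed.

(** Integrating the pointwise bound, the linear terms add up to 1. Since [dist2 mu g' f <= D / C]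
    with [D = dist2 mu g g'], the two error terms are each at most [D ^ 2 / (64 b)], so the gain
    [1 / 8] drops to [1 / 8 - 2 / 64 = 3 / 32]. *)
Lemma affinity_le (a b C delta : R) (f g g' : T -> R) : 0 < a -> a < b ->
  16 * b / a <= C -> 0 <= delta ->
  in_class mu a b f -> in_class mu a b g -> in_class mu a b g' ->
  dist2 mu g' f <= delta -> C * delta <= dist2 mu g g' ->
  \int[mu]_x (f x * Num.sqrt (g x / g' x)) <= 1 - 3 / 32 / b * dist2 mu g g' ^+ 2.
Proof.
move=> a0 ab Cge d0 cf cg cg' df Dg.
have b0 : 0 < b by lra.
have C0 : 0 < C by apply: lt_le_trans Cge; rewrite divr_gt0//; lra.
have bf := in_class_bm a0 cf; have bg := in_class_bm a0 cg.
have bg' := in_class_bm a0 cg'.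
have bmZ (r : R) h : bounded_measurable h -> bounded_measurable (fun x : T => r * h x).
  by move=> bh; apply: bmM => //; exact: bm_cst.
have bs1 := bm_sqrB bg bg'; have bs2 := bm_sqrB bg' bf.
pose k1 := (4 * a * C)^-1 - (8 * b)^-1; pose k2 := C / (4 * a).
have B1 := bmZ 2^-1 _ bg; have B2 := bmB bf (bmZ 2^-1 _ bg').
have B3 := bmZ k1 _ bs1; have B4 := bmZ k2 _ bs2.
have B12 := bmD B1 B2; have B123 := bmD B12 B3.
have le1 : \int[mu]_x (f x * Num.sqrt (g x / g' x)) <=
    \int[mu]_x (2^-1 * g x + (f x - 2^-1 * g' x) + k1 * (g x - g' x) ^+ 2
                + k2 * (g' x - f x) ^+ 2).
  apply: le_Rintegral_bm.
  - by apply: bmM => //; exact: bm_sqrt_ratio cg cg'.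
  - exact: bmD.
  - move=> x; case: cg cg' => _ gab _ [_ gab' _].
    by rewrite affinity_pointwise.
apply: le_trans le1 _.
rewrite RintegralD_bm// RintegralD_bm// RintegralD_bm// RintegralB_bm//; last exact: bmZ.
rewrite !RintegralZ_bm// -!dist2_sqr.
rewrite (in_class_Rintegral cf) (in_class_Rintegral cg) (in_class_Rintegral cg').
set D := dist2 mu g g' in Dg *.
have le2 : k2 * dist2 mu g' f ^+ 2 <= (4 * a * C)^-1 * D ^+ 2.
  have -> : (4 * a * C)^-1 * D ^+ 2 = k2 * (D / C) ^+ 2.
    by rewrite /k2; field; rewrite !gt_eqF.
  rewrite /k2 ler_wpM2l ?divr_ge0//; [lra|lra|].
  rewrite lerXn2r ?nnegrE ?dist2_ge0 ?divr_ge0 ?dist2_ge0 ?(ltW C0)//.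
  by apply: le_trans df _; rewrite ler_pdivlMr// mulrC.
have le3 : (4 * a * C)^-1 <= (64 * b)^-1.
  by move: Cge; rewrite ler_pdivrMr// lef_pV2 ?posrE ?mulr_gt0//; lra.
have : k1 * D ^+ 2 + (4 * a * C)^-1 * D ^+ 2 <= - (3 / 32 / b) * D ^+ 2.
  rewrite -mulrDl ler_wpM2r ?sqr_ge0// /k1.
  have -> : - (3 / 32 / b) = (64 * b)^-1 + (64 * b)^-1 - (8 * b)^-1 by field; rewrite gt_eqF.
  lra.
lra.
Qed.

End Affinity.

(** * Outer probability bounds and union bounds *)

Section OuterBound.
Context {R : realType} {dO : measure_display} {O : measurableType dO}.
Variable P : probability O R.

(* Carrying a measurable superset spares every measurability proof for [E]. *)
Definition outer_bound (E : set O) (b : R) : Prop :=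
  exists U, [/\ measurable U, E `<=` U & (P U <= b%:E)%E].

Lemma outer_bound_le E b b' : b <= b' -> outer_bound E b -> outer_bound E b'.
Proof.
move=> bb' [U [mU EU PU]]; exists U; split => //.
by apply: le_trans PU _; rewrite lee_fin.
Qed.

Lemma outer_bound_sub E E' b : E `<=` E' -> outer_bound E' b -> outer_bound E b.
Proof.
by move=> EE' [U [mU EU PU]]; exists U; split => //; exact: subset_trans EU.
Qed.

Lemma outer_bound0 : outer_bound set0 0.
Proof. by exists set0; split => //; rewrite measure0. Qed.

Lemma outer_bound_bigcup (I : eqType) (s : seq I) (E : I -> set O) (b : I -> R) :
  (forall i, i \in s -> outer_bound (E i) (b i)) ->
  outer_bound [set w | exists2 i, i \in s & E i w] (\sum_(i <- s) b i).
Proof.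
elim: s => [|i s IH] H.
  by rewrite big_nil; apply: outer_bound_sub outer_bound0 => w [].
have [U [mU EU PU]] := H i (mem_head _ _).
have [V [mV EV PV]] : outer_bound [set w | exists2 i, i \in s & E i w] (\sum_(i <- s) b i).
  by apply: IH => j js; apply: H; rewrite inE js orbT.
exists (U `|` V); split; first exact: measurableU.
  move=> w [j]; rewrite inE => /orP[/eqP -> /EU|js Ej]; first by left.
  by right; apply: EV; exists j.
rewrite big_cons EFinD; apply: le_trans (measureU2 _ _ _) _ => //.
exact: leeD.
Qed.

Lemma outer_bound_bigcup_cst (I : eqType) (s : seq I) (E : I -> set O) (b : R) :
  (forall i, i \in s -> outer_bound (E i) b) ->
  outer_bound [set w | exists2 i, i \in s & E i w] ((size s)%:R * b).
Proof.
move=> H; have := outer_bound_bigcup H.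
by rewrite big_const_seq count_predT iter_addr_0 mulr_natl.
Qed.

(** The integral of a nonnegative function is a supremum over simple functions below it, which is
    monotone for arbitrary functions. This covers the loss of the estimator, whose dependence on the
    sample point may fail to be measurable. *)
Lemma le_integral_nonmeasurable (g h : O -> \bar R) :
  (forall w, (0 <= g w)%E) -> (forall w, (g w <= h w)%E) ->
  (\int[P]_w g w <= \int[P]_w h w)%E.
Proof.
move=> g0 gh; rewrite !ge0_integralTE//; last by move=> w; exact: le_trans (gh w).
apply: ereal_sup_le => _ [k kg <-].
by exists k => // w; exact: le_trans (gh w).
Qed.

End OuterBound.

(** * Exponential Markov inequality for independent observations *)

Section Chernoff.
Context {R : realType} {dT : measure_display} {T : measurableType dT}.
Variable mu : probability T R.

Local Notation bm := bounded_measurable.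

Lemma bm_indic (A : set T) : measurable A -> bm (\1_A : T -> R).
Proof.
move=> mA; split; first exact: measurable_indic.
by exists 1 => x; rewrite indicE; case: (x \in A); rewrite ?normr0 ?normr1.
Qed.

Lemma bm_sum (I : Type) (s : seq I) (g : I -> T -> R) :
  (forall i, bm (g i)) -> bm (fun x => \sum_(i <- s) g i x).
Proof.
move=> bg; elim: s => [|i s IH].
  by under eq_fun do rewrite big_nil; exact: bm_cst.
by under eq_fun do rewrite big_cons; exact: bmD.
Qed.

Lemma Rintegral_sum_bm (I : Type) (s : seq I) (g : I -> T -> R) :
  (forall i, bm (g i)) ->
  \int[mu]_x (\sum_(i <- s) g i x) = \sum_(i <- s) \int[mu]_x g i x.
Proof.
move=> bg; elim: s => [|i s IH].
  by rewrite big_nil -[RHS](Rintegral_cst_prob mu); apply: eq_Rintegral => x _; rewrite big_nil.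
rewrite big_cons -IH -RintegralD_bm//; last exact: bm_sum.
by apply: eq_Rintegral => x _; rewrite big_cons.
Qed.

Lemma integral_indic_bm (f : T -> R) (A : set T) : bm f -> measurable A ->
  (\int[mu]_(x in A) (f x)%:E)%E = (\int[mu]_x (f x * \1_A x))%:E.
Proof.
move=> bf mA; rewrite -integral_bm; last exact: bmM (bm_indic mA).
rewrite [LHS]integral_mkcond; apply: eq_integral => x _.
by rewrite /patch indicE; case: (x \in A); rewrite ?mulr1 ?mulr0.
Qed.

Context {dO : measure_display} {O : measurableType dO}.
Variables (P : probability O R) (N : nat) (Xt : 'I_N -> O -> T) (f : T -> R).
Hypothesis mXt : forall i, measurable_fun setT (Xt i).
Hypothesis iidX : iid_density mu P Xt f.
Hypotheses (bf : bm f) (f0 : forall x, 0 <= f x) (intf : \int[mu]_x f x = 1).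

(* [phi] is rounded up to a multiple of [eta]; the event is then covered by the
   boxes on which the rounded product is at least 1, and Markov's inequality
   together with independence bounds their total mass. *)
Lemma chernoff_outer (phi : T -> R) (I : {set 'I_N}) (eta : R) :
  bm phi -> (forall x, 0 <= phi x) -> 0 < eta ->
  outer_bound P [set w | 1 <= \prod_(i in I) phi (Xt i w)]
    ((\int[mu]_x (f x * phi x) + eta) ^+ #|I|).
Proof.
move=> bphi phi0 eta0; have [mphi [M phiM]] := bphi.
pose Q := (Num.truncn (M / eta)).+1.
pose B (r : 'I_Q) : set T := [set x | r%:R * eta <= phi x < r.+1%:R * eta].
have mB r : measurable (B r).
  rewrite (_ : B r = phi @^-1` [set` `[r%:R * eta, r.+1%:R * eta[ ]).
    by rewrite -[X in measurable X]setTI; apply: mphi => //; exact: measurable_itv.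
  by apply/seteqP; split => x /=; rewrite in_itv.
have ltQ x : (Num.truncn (phi x / eta) < Q)%N.
  rewrite ltnS truncn_le_nat; apply: le_lt_trans (truncnS_gt (M / eta)).
  by rewrite ler_pM2r ?invr_gt0//; apply: le_trans (phiM x); exact: ler_norm.
pose bin x : 'I_Q := Ordinal (ltQ x).
have binP x r : B r x <-> r = bin x.
  have e0 : 0 <= phi x / eta by rewrite divr_ge0// ltW.
  have -> : B r x = (r%:R <= phi x / eta < r.+1%:R) :> Prop.
    by rewrite /B/= ler_pdivlMr// ltr_pdivrMr.
  rewrite -truncn_eq//; split=> [/eqP e|->]; last by rewrite eqxx.
  by apply: val_inj; rewrite /= e.
pose p r := \int[mu]_x (f x * \1_(B r) x).
have p0 r : 0 <= p r.
  by apply: Rintegral_ge0 => x _; rewrite mulr_ge0.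
have Pp i r : P (Xt i @^-1` B r) = (p r)%:E.
  by rewrite iidX.1// integral_indic_bm.
(* The upper end of the bin on coordinates in [I]; the value 1 makes the other coordinates neutral
   in the product. *)
pose y (i : 'I_N) (r : 'I_Q) : R := if i \in I then r.+1%:R * eta else 1.
have y0 i r : 0 <= y i r.
  by rewrite /y; case: ifP => // _; rewrite mulr_ge0// ltW.
pose box (rho : {ffun 'I_N -> 'I_Q}) := [set w | forall i, B (rho i) (Xt i w)].
have boxb rho : outer_bound P (box rho) (\prod_i p (rho i)).
  exists (box rho); split => //; last first.
    rewrite /box (iidX.2 (fun i => B (rho i)) (fun i => mB (rho i))) -prodEFin.
    by under eq_bigr do rewrite Pp.
  rewrite (_ : box rho = \bigcap_(i in [set: 'I_N]) (Xt i @^-1` B (rho i))).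
    apply: fin_bigcap_measurable => // i _.
    by rewrite -[X in measurable X]setTI; apply: mXt.
  by apply/seteqP; split => [w h i _|w h i]; [exact: h|exact: (h i)].
pose s := [seq rho : {ffun 'I_N -> 'I_Q} <- index_enum {ffun 'I_N -> 'I_Q} |
             1 <= \prod_i y i (rho i)].
have := @outer_bound_bigcup _ _ _ P _ s box _ (fun rho _ => boxb rho).
have sub : [set w | 1 <= \prod_(i in I) phi (Xt i w)] `<=`
    [set w | exists2 rho, rho \in s & box rho w].
  move=> w /= hw; pose rho := [ffun i => bin (Xt i w)].
  exists rho; last by move=> i; apply/binP; rewrite ffunE.
  rewrite mem_filter mem_index_enum andbT; apply: le_trans hw _.
  rewrite [leLHS]big_mkcond/=; apply: ler_prod => i _.
  rewrite /y ffunE; case: ifP => _; last by rewrite ler01 lexx.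
  rewrite phi0/=.
  by have /binP/andP[_ /ltW] : bin (Xt i w) = bin (Xt i w).
move=> /(outer_bound_sub sub); apply: outer_bound_le; rewrite /s big_filter.
apply: (@le_trans _ _ (\sum_(rho : {ffun 'I_N -> 'I_Q}) \prod_i (y i (rho i) * p (rho i)))).
  rewrite big_mkcond/=; apply: ler_sum => rho _; rewrite big_split/=.
  have pp : 0 <= \prod_i p (rho i) by apply: prodr_ge0.
  case: ifP => [h|_]; first by rewrite ler_peMl.
  by rewrite mulr_ge0// prodr_ge0.
(* Independence enters here: the sum over all boxes factors into one sum per coordinate, each an
   integral of the rounded function against [f]. *)
rewrite -(bigA_distr_bigA (fun i r => y i r * p r)).
have sumE i : \sum_r y i r * p r =
    \int[mu]_x (\sum_r y i r * (f x * \1_(B r) x)).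
  rewrite Rintegral_sum_bm; last first.
    by move=> r; apply: bmM; [exact: bm_cst|exact: bmM (bm_indic (mB r))].
  apply: eq_bigr => r _.
  by rewrite RintegralZ_bm//; exact: bmM (bm_indic (mB r)).
have binE i x : \sum_r y i r * (f x * \1_(B r) x) = f x * y i (bin x).
  rewrite (bigD1 (bin x))//= big1 ?addr0.
    have -> : \1_(B (bin x)) x = 1 :> R by rewrite indicE mem_set//; apply/binP.
    by rewrite mulr1 mulrC.
  move=> r rx; rewrite indicE memNset ?mulr0//.
  by move=> /binP e; rewrite e eqxx in rx.
rewrite (bigID (mem I))/= -[leRHS]mulr1; apply: ler_pM.
- by apply: prodr_ge0 => i _; apply: sumr_ge0 => r _; rewrite mulr_ge0.
- by apply: prodr_ge0 => i _; apply: sumr_ge0 => r _; rewrite mulr_ge0.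
- rewrite -prodr_const; apply: ler_prod => i iI; apply/andP; split.
    by apply: sumr_ge0 => r _; rewrite mulr_ge0.
  have -> : \int[mu]_x (f x * phi x) + eta = \int[mu]_x (f x * phi x + eta * f x).
    rewrite RintegralD_bm; [|exact: bmM|by apply: bmM => //; exact: bm_cst].
    by rewrite RintegralZ_bm// intf mulr1.
  rewrite sumE; apply: le_Rintegral_bm.
  + by apply: bm_sum => r; apply: bmM; [exact: bm_cst|exact: bmM (bm_indic (mB r))].
  + by apply: bmD; apply: bmM => //; exact: bm_cst.
  + move=> x; have /andP[h _] : B (bin x) x by apply/binP.
    rewrite binE [eta * _]mulrC -mulrDr ler_wpM2l// /y iI -natr1 mulrDl mul1r.
    by rewrite lerD2r.
- rewrite big1// => i /negbTE iI; rewrite sumE -[RHS]intf.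
  by apply: eq_Rintegral => x _; rewrite binE /y iI mulr1.
Qed.

End Chernoff.

(** * Deviation bounds for the groupwise comparison *)

Section GroupTest.
Context {R : realType} {dT : measure_display} {T : measurableType dT}.
Variable mu : probability T R.

(** The inequality is not strict, so that the complement consists exactly of the groups counted by
    [psi grp u v]. *)
Definition bad_groups (N G : nat) (grp : 'I_N -> 'I_G) (v u : T -> R)
    (x : 'I_N -> T) : {set 'I_G} :=
  [set l | 0 <= \sum_(i < N | grp i == l) ln (v (x i) / u (x i))]%SET.

Lemma card_group_preimage (N k G : nat) (grp : 'I_N -> 'I_G) (A : {set 'I_G}) :
  (forall j, #|[set i : 'I_N | grp i == j]%SET| = k) ->
  #|[set i | grp i \in A]%SET| = (k * #|A|)%N.
Proof.
move=> gk; rewrite -sum1_card (partition_big grp (mem A))/=; last first.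
  by move=> i; rewrite inE.
rewrite mulnC -sum_nat_const; apply: eq_bigr => l lA.
rewrite -[RHS](gk l) -sum1_card; apply: eq_bigl => i.
by rewrite !inE andbC; case: eqP => // ->; rewrite lA.
Qed.

Context {dO : measure_display} {O : measurableType dO}.
Variables (P : probability O R) (N k : nat) (grp : 'I_N -> 'I_(N %/ k)).
Variables (Xt : 'I_N -> O -> T) (f : T -> R) (a b C delta : R).
Hypotheses (a0 : 0 < a) (ab : a < b).
Hypothesis mXt : forall i, measurable_fun setT (Xt i).
Hypothesis iidX : iid_density mu P Xt f.
Hypotheses (k0 : (0 < k)%N) (kN : (k %| N)%N).
Hypothesis grpk : forall j, #|[set i : 'I_N | grp i == j]%SET| = k.
Hypothesis cf : in_class mu a b f.
Hypotheses (Cab : 16 * b / a <= C) (CL : 1 + Num.sqrt ((a * cab a b)^-1) < C).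
Hypothesis delta0 : 0 < delta.

Let L := Lab a b C.

(** The event says that the product of [sqrt (v / u)] over [I] is at least 1, so [chernoff_outer]
    applies with the moment bound of [affinity_le]. *)
Lemma loglik_sum_outer (u v : T -> R) (I : {set 'I_N}) :
  in_class mu a b u -> in_class mu a b v ->
  dist2 mu u f <= delta -> C * delta <= dist2 mu u v ->
  outer_bound P [set w | 0 <= \sum_(i in I) ln (v (Xt i w) / u (Xt i w))]
    (expR (- (L * delta ^+ 2 / 2 * #|I|%:R))).
Proof.
have a_gt0 := a0; have b0 : 0 < b by exact: lt_trans ab.
move=> cu cv uf uv.
have C0 : 0 < C by apply: lt_le_trans Cab; rewrite divr_gt0//; lra.
have aff := affinity_le a0 ab Cab (ltW delta0) cf cv cu uf.
rewrite [dist2 mu v u]dist2C in aff; have {}aff := aff uv.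
set D := dist2 mu u v in uv aff.
have D0 : 0 < D by apply: lt_le_trans uv; rewrite mulr_gt0.
(* A quarter of the gain [3 / 32 / b]; the remaining [9 / 128 / b * D ^ 2] still dominates
   [L delta ^ 2 / 2]. *)
pose eta := 3 / 128 / b * D ^+ 2.
have eta0 : 0 < eta.
  by rewrite /eta mulr_gt0 ?exprn_gt0// divr_gt0//; lra.
pose phi x := Num.sqrt (v x / u x).
have bphi : bounded_measurable phi by exact: bm_sqrt_ratio cv cu.
have f0 x : 0 <= f x.
  by case: cf => _ /(_ x)/andP[af _] _; lra.
have phi0 x : 0 <= phi x by exact: sqrtr_ge0.
have := chernoff_outer mXt iidX (in_class_bm a0 cf) f0 (in_class_Rintegral cf)
          I bphi phi0 eta0.
set q := _ + eta => H.
have q0 : 0 <= q.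
  apply: addr_ge0; last exact: ltW.
  by apply: Rintegral_ge0 => x _; rewrite mulr_ge0.
have LD : L * delta ^+ 2 <= 9 / 64 / b * D ^+ 2.
  have /andP[L0 L1] := Lab_bounds a0 ab CL.
  apply: (@le_trans _ _ (9 / 64 / b * C ^+ 2 * delta ^+ 2)).
    by rewrite ler_wpM2r// sqr_ge0.
  rewrite -mulrA -exprMn ler_wpM2l ?divr_ge0//; [lra..|].
  by rewrite lerXn2r// nnegrE ?mulr_ge0// ltW.
have qe : q <= expR (- (L * delta ^+ 2 / 2)).
  apply: le_trans (expR_ge1Dx _).
  rewrite /q; apply: le_trans (lerD aff (lexx eta)) _.
  rewrite /eta.
  have -> : 3 / 32 / b * D ^+ 2 = 3 / 128 / b * D ^+ 2 + 9 / 64 / b * D ^+ 2 / 2 by field; lra.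
  lra.
apply: outer_bound_le (outer_bound_sub _ H).
  rewrite -mulNr expRM_natr lerXn2r// nnegrE.
  exact: expR_ge0.
move=> w /= hw.
rewrite (eq_bigr (fun i => expR (2^-1 * ln (v (Xt i w) / u (Xt i w))))).
  by rewrite -expR_sum -mulr_sumr -expR0 ler_expR mulr_ge0// invr_ge0.
move=> i _; rewrite /phi sqrt_ratio_expR//.
  by case: cv => _ /(_ (Xt i w))/andP[av _] _; lra.
by case: cu => _ /(_ (Xt i w))/andP[av _] _; lra.
Qed.

(* Some set of at least [N / (6 k)] groups has nonnegative total log-likelihood;
   there are at most [2 ^ (N / k)] such sets. *)
Lemma bad_groups_outer (u v : T -> R) :
  in_class mu a b u -> in_class mu a b v ->
  dist2 mu u f <= delta -> C * delta <= dist2 mu u v ->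
  24 <= k%:R * (L * delta ^+ 2) ->
  outer_bound P
    [set w | N%:R / (6 * k%:R) <=
             (#|bad_groups grp v u (Xt^~ w)|%:R : R)]
    (expR (- (N%:R * (L / 24 * delta ^+ 2)))).
Proof.
move=> cu cv uf uv klarge.
have kR : 0 < k%:R :> R by rewrite ltr0n.
pose I (A : {set 'I_(N %/ k)}) := [set i : 'I_N | grp i \in A]%SET.
pose E (A : {set 'I_(N %/ k)}) :=
  [set w | 0 <= \sum_(i in I A) ln (v (Xt i w) / u (Xt i w))].
pose s := [seq A : {set 'I_(N %/ k)} <- enum (powerset [set: 'I_(N %/ k)]%SET) |
             N%:R / (6 * k%:R) <= (#|A|%:R : R)].
have L0 : 0 < L by have /andP[] := Lab_bounds a0 ab CL.
have /(@outer_bound_bigcup_cst _ _ _ P _ s E) : forall A, A \in s ->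
    outer_bound P (E A) (expR (- (L * delta ^+ 2 / 2 * (N%:R / 6)))).
  move=> A; rewrite mem_filter => /andP[hA _].
  apply: outer_bound_le (loglik_sum_outer (I A) cu cv uf uv).
  rewrite ler_expR lerN2 (card_group_preimage _ grpk) natrM.
  apply: ler_wpM2l; first by rewrite divr_ge0// mulr_ge0 ?sqr_ge0// ltW.
  by move: hA; rewrite invfM mulrA ler_pdivrMr// [k%:R * _]mulrC.
move=> H; apply: (outer_bound_le _ (outer_bound_sub _ H)); last first.
  move=> w /= hw; exists (bad_groups grp v u (Xt^~ w)).
    by rewrite mem_filter hw mem_enum inE finset.subsetT.
  rewrite /E/= (partition_big grp (mem (bad_groups grp v u (Xt^~ w))))/=; last first.
    by move=> i; rewrite inE.
  apply: sumr_ge0 => l lA; move: (lA); rewrite inE => h.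
  rewrite (eq_bigl (fun i => grp i == l))// => i.
  by rewrite !inE andbC; case: eqP => //= ->; rewrite h.
have szs : (size s <= 2 ^ (N %/ k))%N.
  rewrite /s size_filter; apply: leq_trans (count_size _ _) _.
  by rewrite -cardE card_powerset cardsT card_ord.
(* The number of sets of groups costs at most [N / k] in the exponent [N L delta ^ 2 / 12]. By
   [24 <= k L delta ^ 2] this is at most half of it. *)
have two_e : 2 <= expR 1 :> R.
  by apply: le_trans (expR_ge1Dx 1); lra.
have NkE : (N %/ k)%:R = N%:R / k%:R :> R.
  by rewrite -[in RHS](divnK kN) natrM mulfK// gt_eqF.
apply: (@le_trans _ _ (expR ((N %/ k)%:R) * expR (- (L * delta ^+ 2 / 2 * (N%:R / 6))))).
  rewrite ler_wpM2r ?expR_ge0// -[in leRHS](mulr1 (N %/ k)%:R) expRM_natl.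
  apply: (@le_trans _ _ (2 ^+ (N %/ k))); first by rewrite -natrX ler_nat.
  by apply: lerXn2r => //; rewrite nnegrE ?expR_ge0.
rewrite -expRD ler_expR NkE.
have -> : N%:R / k%:R - L * delta ^+ 2 / 2 * (N%:R / 6) =
   - (N%:R * (L / 24 * delta ^+ 2))
   - N%:R / k%:R * ((k%:R * (L * delta ^+ 2) - 24) / 24).
  by field; rewrite gt_eqF.
by rewrite gerBl mulr_ge0// divr_ge0//; lra.
Qed.

End GroupTest.

(** * The selection rule under corruption *)

Section Selection.
Context {R : realType} {dT : measure_display} {T : measurableType dT}.
Variable mu : probability T R.

Lemma inlP (u : T -> R) (S : seq (T -> R)) : inl u S <-> u \in S.
Proof.
split=> [[i iS <-]|uS]; first exact: mem_nth.
by exists (index u S); [rewrite index_mem | exact: nth_index].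
Qed.

(** A corrupted observation affects only its own group, so at most [N / (3 k)] groups are added. As
    [1 / 6 + 1 / 3 = 1 / 2], fewer than half of the groups are bad, which settles the comparison in
    both directions. *)
Lemma psi_of_few_bad_groups (N k : nat) (grp : 'I_N -> 'I_(N %/ k))
    (x xt : 'I_N -> T) (S : {set 'I_N}) (u v : T -> R) :
  (0 < k)%N -> (k %| N)%N ->
  (forall y, 0 < u y) -> (forall y, 0 < v y) ->
  (#|S|%:R : R) <= (3 * k%:R)^-1 * N%:R ->
  (forall i, i \notin S -> x i = xt i) ->
  (#|bad_groups grp v u xt|%:R : R) < N%:R / (6 * k%:R) ->
  psi grp v u x = false /\ psi grp u v x = true.
Proof.
move=> k0 kN u0 v0 cS xS bad.
have kR : 0 < k%:R :> R by rewrite ltr0n.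
have NkE : (N %/ k)%:R = N%:R / k%:R :> R.
  by rewrite -[in RHS](divnK kN) natrM mulfK// gt_eqF.
have sub : bad_groups grp v u x \subset (bad_groups grp v u xt :|: grp @: S)%SET.
  apply/fintype.subsetP => l; rewrite finset.in_setU.
  have [//|lS] := boolP (l \in (grp @: S)%SET); first by rewrite orbT.
  rewrite orbF !inE => h; rewrite (eq_bigr (fun i => ln (v (x i) / u (x i))))//.
  move=> i /eqP gi; rewrite xS//; apply: contraNN lS => iS.
  by rewrite -gi imset_f.
have lebad : (#|bad_groups grp v u x|%:R : R) < N%:R / (2 * k%:R).
  have le1 : (#|bad_groups grp v u x| <= #|bad_groups grp v u xt| + #|S|)%N.
    apply: leq_trans (subset_leq_card sub) _.
    by apply: leq_trans (leq_card_setU _ _) _; rewrite leq_add2l leq_imset_card.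
  rewrite -(ler_nat R) natrD in le1; apply: le_lt_trans le1 _.
  have -> : N%:R / (2 * k%:R) = N%:R / (6 * k%:R) + (3 * k%:R)^-1 * N%:R :> R.
    by field; rewrite gt_eqF.
  exact: ltr_leD.
split; rewrite /psi.
  apply/negbTE; rewrite -ltNge; apply: le_lt_trans lebad.
  by rewrite ler_nat; apply/subset_leq_card/fintype.subsetP => l; rewrite !inE => /ltW.
rewrite (_ : [set j | _]%SET = (~: bad_groups grp v u x)%SET).
  have := cardsC (bad_groups grp v u x); rewrite card_ord => e.
  have : (#|bad_groups grp v u x|%:R : R) + #|(~: bad_groups grp v u x)%SET|%:R
      = N%:R / k%:R by rewrite -natrD e NkE.
  have -> : N%:R / k%:R = N%:R / (2 * k%:R) + N%:R / (2 * k%:R) :> R.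
    by field; rewrite gt_eqF.
  lra.
apply/finset.setP => l; rewrite !inE -ltNge -oppr_gt0 -sumrN; congr (_ < _).
apply: eq_bigr => i _; rewrite !ln_div ?posrE//; lra.
Qed.

(** No distant candidate beats [u], so its [Tsel] is 0 and the minimum is 0. A distant [nu] is
    beaten by [u] and has [Tsel] at least [C * delta > 0]. *)
Lemma selected_near (N k : nat) (grp : 'I_N -> 'I_(N %/ k)) (C delta : R)
    (x : 'I_N -> T) (S : seq (T -> R)) (u nu : T -> R) :
  0 < C * delta -> u \in S ->
  (forall v, v \in S -> C * delta <= dist2 mu u v ->
     psi grp v u x = false /\ psi grp u v x = true) ->
  selected mu grp C delta x S nu -> dist2 mu u nu < C * delta.
Proof.
move=> C0 uS H [/inlP nuS min]; rewrite ltNge; apply/negP => far.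
have Tu : Tsel mu grp C delta x S u = 0.
  rewrite /Tsel big_seq_cond big_pred0// => v; apply/negbTE/negP.
  by move=> /and3P[vS pv fv]; have [e _] := H v vS fv; rewrite e in pv.
have := min u ((inlP u S).2 uS); rewrite Tu; apply/negP; rewrite -ltNge.
have [_ pu] := H _ nuS far.
rewrite dist2C in far; apply: lt_le_trans C0 (le_trans (far) _).
by apply: le_bigmax_seq => //; rewrite pu far.
Qed.

End Selection.

(** * The merging step of the tree construction *)

Section Merge.
Context {R : realType} {dT : measure_display} {T : measurableType dT}.
Variable mu : probability T R.
Implicit Types (l : seq ((T -> R) * (T -> R))).

(* Merging acts on candidates alone: [h u] is the first list head near [u]. *)
Lemma merge_auxP (eta : R) n l : 0 <= eta -> (size l <= n)%N ->
  exists h : (T -> R) -> (T -> R),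
  [/\ forall p, p \in merge_aux mu eta n l <-> exists2 y, y \in l & p = (y.1, h y.2),
      forall y, y \in l -> dist2 mu y.2 (h y.2) <= eta,
      forall y, y \in l -> exists2 z, z \in l & h y.2 = z.2
    & forall y z, y \in l -> z \in l ->
        h y.2 = h z.2 \/ eta < dist2 mu (h y.2) (h z.2)].
Proof.
move=> eta0; elim: n l => [|n IH] [|x rest] //=;
  [by exists id; split => // p; split => // -[y]
  |by exists id; split => // p; split => // -[y]|].
rewrite ltnS => sz; pose rest' := [seq y <- rest | ~~ (dist2 mu y.2 x.2 <= eta)].
have /IH[h' [h1 h2 h3 h4]] : (size rest' <= n)%N.
  by rewrite size_filter; exact: leq_trans (count_size _ _) sz.
pose h u := if dist2 mu u x.2 <= eta then x.2 else h' u.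
have hx : h x.2 = x.2 by rewrite /h dist2xx eta0.
have hcase y : y \in x :: rest ->
    (dist2 mu y.2 x.2 <= eta /\ h y.2 = x.2) \/ (y \in rest' /\ h y.2 = h' y.2).
  rewrite inE /h; case: ifPn => [near _|far yr]; first by left.
  right; split => //; rewrite mem_filter far; case/predU1P: yr => // e.
  by rewrite e dist2xx eta0 in far.
have rest'P y : y \in rest' -> y \in x :: rest.
  by rewrite mem_filter inE => /andP[_ ->]; rewrite orbT.
have h'far y : y \in rest' -> eta < dist2 mu (h' y.2) x.2.
  by move=> /h3[z]; rewrite mem_filter => /andP[zf _] ->; rewrite ltNge.
exists h; split.
- move=> p; rewrite inE mem_cat; split.
    case/or3P.
    + by move=> /eqP ->; exists x; rewrite ?mem_head// hx -surjective_pairing.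
    + move=> /mapP[y]; rewrite mem_filter => /andP[yx yr] ->.
      by exists y; rewrite ?inE ?yr ?orbT// /h yx.
    + move=> /h1[y yr ->]; exists y; first exact: rest'P.
      by move: yr; rewrite mem_filter /h => /andP[/negbTE -> _].
  move=> [y yl ->]; have [[near ->]|[yr ->]] := hcase y yl; last first.
    by apply/or3P; apply: Or33; apply/h1; exists y.
  move: yl; rewrite inE => /predU1P[->|yr].
    by rewrite -surjective_pairing eqxx.
  apply/or3P; apply: Or32; apply/mapP; exists y => //.
  by rewrite mem_filter near.
- by move=> y /hcase[[near ->]|[yr ->]] //; exact: h2.
- move=> y /hcase[[_ ->]|[yr ->]]; first by exists x; rewrite ?mem_head.
  by have [z zr ->] := h3 _ yr; exists z => //; exact: rest'P.
- move=> y z /hcase[[_ ->]|[yr ->]] /hcase[[_ ->]|[zr ->]].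
  + by left.
  + by right; rewrite dist2C; exact: h'far.
  + by right; exact: h'far.
  + exact: h4.
Qed.

End Merge.

(** * Packings and local entropy of a star-shaped class *)

Section Packing.
Context {R : realType} {dT : measure_display} {T : measurableType dT}.
Variables (mu : probability T R) (F : set (T -> R)).
Hypothesis bF : forall g, F g -> bounded_measurable g.

Lemma packing_mem (eta : R) (S : set (T -> R)) Pk u :
  is_packing mu eta S Pk -> u \in Pk -> S u.
Proof. by move=> [H _] /inlP/H. Qed.

Lemma packing_sep (eta : R) (S : set (T -> R)) Pk u v :
  is_packing mu eta S Pk -> u \in Pk -> v \in Pk -> u = v \/ eta < dist2 mu u v.
Proof.
move=> [_ H] /inlP[i iP <-] /inlP[j jP <-].
by have [->|/eqP ij] := eqVneq i j; [left|right; exact: H].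
Qed.

Lemma maximal_packing_cover (eta : R) (S : set (T -> R)) Pk g :
  maximal_packing mu eta S Pk -> S g -> exists2 u, u \in Pk & dist2 mu u g <= eta.
Proof.
move=> [_ H] Sg; apply: contrapT => N; apply: H; exists g; split => // u /inlP uP.
by rewrite ltNge; apply/negP => le; apply: N; exists u => //; rewrite dist2C.
Qed.

Lemma uniq_packing (eta : R) (S : set (T -> R)) (s : seq (T -> R)) : uniq s ->
  (forall u, u \in s -> S u) ->
  (forall u v, u \in s -> v \in s -> u = v \/ eta < dist2 mu u v) ->
  is_packing mu eta S s.
Proof.
move=> us Ss sep; split=> [u /inlP/Ss //|i j iS jS ij].
have [e|//] := sep _ _ (mem_nth (fun=> 0) iS) (mem_nth (fun=> 0) jS).
by move/eqP: e; rewrite nth_uniq// => /eqP.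
Qed.

(** The homothety of ratio [t] centred at the star centre maps [F] into itself. Hence the local
    entropy with a fixed ratio [c'] can only grow as the scale shrinks. *)
Lemma packing_contract (t eta r : R) g Pk : star_shaped F -> 0 < t <= 1 -> F g ->
  is_packing mu eta (F `&` ball2 mu g r) Pk ->
  exists g' Pk', [/\ F g', is_packing mu (t * eta) (F `&` ball2 mu g' (t * r)) Pk'
    & size Pk' = size Pk].
Proof.
move=> [f0 [Ff0 star]] /andP[t0 t1] Fg pack; have [H1 H2] := pack.
have t01 : 0 <= t <= 1 by rewrite ltW.
pose Phi (h : T -> R) := fun x => t * h x + (1 - t) * f0 x.
have distPhi h h' : F h -> F h' -> dist2 mu (Phi h) (Phi h') = t * dist2 mu h h'.
  by move=> /bF bh /bF bh'; apply: dist2_contract => //; exact: ltW.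
have FP i : (i < size Pk)%N -> F (Defs.nth0 Pk i) /\ dist2 mu g (Defs.nth0 Pk i) <= r.
  by move=> iP; apply: H1; exists i.
exists (Phi g), (map Phi Pk); split; [exact: star| |exact: size_map].
split.
  move=> u /inlP/mapP[h hP ->].
  have [Fh gh] := packing_mem pack hP.
  split; first exact: star.
  by rewrite /ball2/= distPhi// ler_pM2l.
move=> i j; rewrite size_map => iP jP ij.
rewrite /Defs.nth0 !(nth_map (fun=> 0))// distPhi ?ltr_pM2l//; first exact: H2.
  exact: (FP i iP).1.
exact: (FP j jP).1.
Qed.

Lemma local_entropy_packing (tau c' : R) (m : nat) g Pk :
  local_entropy mu F tau c' = (m%:R)%:E -> F g ->
  is_packing mu (tau / c') (F `&` ball2 mu g tau) Pk -> (size Pk <= m)%N.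
Proof.
move=> le Fg pack; rewrite -(ler_nat R) -lee_fin -le.
apply: (@le_trans _ _ (packing_number mu (tau / c') (F `&` ball2 mu g tau))).
  by apply: ereal_sup_ubound; exists Pk.
by apply: ereal_sup_ubound; exists g.
Qed.

End Packing.

(** * Separation, size and covering properties of the tree *)

Section Tree.
Context {R : realType} {dT : measure_display} {T : measurableType dT}.
Variables (mu : probability T R) (F : set (T -> R)) (d c : R).
Variables (pk : nat -> (T -> R) -> seq (T -> R)) (root : T -> R) (Jt : nat).
Hypothesis bF : forall g, F g -> bounded_measurable g.
Hypothesis diamF : forall g h, F g -> F h -> dist2 mu g h <= d.
Hypotheses (d0 : 0 <= d) (c1 : 1 <= c).
Hypotheses (Froot : F root) (tree : tree_ok mu F pk root d c Jt).

Local Notation lev := (level mu pk root d c).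
Local Notation off := (offspring mu pk root d c).

Lemma mem_candidates j (L : seq (T -> R)) p :
  p \in candidates pk j L <-> p.1 \in L /\ p.2 \in pk j p.1.
Proof.
rewrite /candidates; split.
  by move=> /flatten_mapP[q qL /mapP[u uq ->]].
case: p => q u /= [qL uq]; apply/flatten_mapP; exists q => //.
by apply/mapP; exists u.
Qed.

Lemma merge_eta_ge0 j : 0 <= merge_eta d c j.
Proof.
by rewrite divr_ge0// mulr_ge0 ?exprn_ge0// (le_trans _ c1).
Qed.

Lemma levelE j : (3 <= j)%N -> lev j =
  [seq y.2 | y <- Defs.merge mu (merge_eta d c j) (candidates pk j (lev j.-1))].
Proof. by case: j => [|[|[|j]]]. Qed.

Lemma offspringE j q : (3 <= j)%N -> off j q =
  [seq y.2 | y <- Defs.merge mu (merge_eta d c j) (candidates pk j (lev j.-1))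
                & `[< y.1 = q >]].
Proof. by case: j => [|[|[|j]]]. Qed.

Lemma offspring2E q : off 2 q = pk 2 q.
Proof. by []. Qed.

Lemma level_subF j u : (j <= Jt)%N -> u \in lev j -> F u.
Proof.
case: j => [//|[|[|j]]] jJ; first by rewrite inE => /eqP ->.
  by have [[pack _] _] := tree => uP; exact: packing_mem pack uP.
rewrite levelE// => /mapP[p pm ->].
have [h [h1 _ h3 _]] := merge_auxP mu (merge_eta_ge0 j.+3)
  (leqnn (size (candidates pk j.+3 (lev j.+2)))).
move: pm => /h1[y /h3[z /mem_candidates[zl zp] e] ->]; rewrite /= e.
have [_ /(_ j.+3 jJ z.1)] := tree.
by move=> /(_ ((inlP _ _).2 zl))[pack _]; have [] := packing_mem pack zp.
Qed.

Lemma level_sep j u v : (2 <= j <= Jt)%N -> u \in lev j -> v \in lev j ->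
  u = v \/ merge_eta d c j < dist2 mu u v.
Proof.
case: j => [//|[//|[|j]]] jJ.
  have [[pack _] _] := tree => uP vP.
  have [->|h] := packing_sep pack uP vP; first by left.
  (* Level 2 is a [d / c]-packing, while [merge_eta d c 2] is only [d / (2 c)]. *)
  right; apply: le_lt_trans h; rewrite /merge_eta/= expr1.
  have c0 : 0 < c by exact: lt_le_trans c1.
  by rewrite ler_wpM2l// lef_pV2 ?posrE ?mulr_gt0//; lra.
rewrite levelE// => /mapP[p pm ->] /mapP[p' pm' ->].
have [h [h1 _ _ h4]] := merge_auxP mu (merge_eta_ge0 j.+3)
  (leqnn (size (candidates pk j.+3 (lev j.+2)))).
move: pm pm' => /h1[y yc ->] /h1[z zc ->]; exact: h4.
Qed.

(** For [j >= 3] the offspring are images of the packing under merging, hence no more numerous. A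
    candidate within [r = d / 2 ^ (j - 2)] of [q] moves by at most [r / 2]. Covering radius and
    merging displacement are each half of the scale [delta_j], so together they give [delta_j]. *)
Lemma offspringP j q : (2 <= j <= Jt)%N -> q \in lev j.-1 ->
  [/\ exists h : (T -> R) -> (T -> R), off j q =i [seq h u | u <- pk j q],
      forall u, u \in off j q -> u \in lev j /\ dist2 mu q u <= 2 * (d / 2 ^+ (j - 2))
    & forall g, F g -> dist2 mu q g <= d / 2 ^+ (j - 2) ->
        exists2 u, u \in off j q & dist2 mu u g <= d / (2 ^+ (j - 2) * c)].
Proof.
have c0 : 0 < c by exact: lt_le_trans c1.
have dg0 := d0.
case: j => [//|[//|[|j]]] jJ ql.
  (* At [j = 2] the only parent is the root, the radius is the full diameter, and there is no
     merging. *)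
  have /eqP -> : q == root by rewrite inE in ql.
  have [maxp _] := tree; rewrite offspring2E.
  split; first by exists id; rewrite map_id.
    move=> u uP; have Fu : F u by have [pack _] := maxp; exact: packing_mem pack uP.
    by split => //; rewrite subnn expr0 divr1; have := diamF Froot Fu; lra.
  move=> g Fg _; have [u uP ug] := maximal_packing_cover maxp Fg.
  by exists u => //; rewrite subnn expr0 mul1r.
have j2J : (j.+2 <= Jt)%N by have /andP[_ /ltnW] := jJ.
have Fq := level_subF j2J ql.
have [_ /(_ j.+3 jJ q ((inlP _ _).2 ql)) maxp] := tree.
have [h [h1 h2 h3 _]] := merge_auxP mu (merge_eta_ge0 j.+3)
  (leqnn (size (candidates pk j.+3 (lev j.+2)))).
have cand u : u \in pk j.+3 q -> (q, u) \in candidates pk j.+3 (lev j.+2).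
  by move=> uP; apply/mem_candidates.
have offP u : u \in off j.+3 q <-> exists2 v, v \in pk j.+3 q & u = h v.
  rewrite offspringE//; split.
    move=> /mapP[p]; rewrite mem_filter => /andP[/asboolP pq /h1[y yc e]] ->.
    exists y.2; last by rewrite e.
    have /mem_candidates[_] := yc; suff -> : y.1 = q by [].
    by rewrite -pq e.
  move=> [v vP ->]; apply/mapP; exists (q, h v) => //.
  rewrite mem_filter/=; apply/andP; split; first exact/asboolP.
  by apply/h1; exists (q, v) => //; exact: cand.
have Fpk u : u \in pk j.+3 q -> F u /\ dist2 mu q u <= d / 2 ^+ (j.+3 - 2).
  by have [pack _] := maxp => uP; have [] := packing_mem pack uP.
have etaE : merge_eta d c j.+3 = d / 2 ^+ (j.+3 - 2) / c / 2.
  rewrite /merge_eta /= subSS subSS subn0 exprS; field.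
  by rewrite gt_eqF// gt_eqF// exprn_gt0.
have r0 : 0 <= d / 2 ^+ (j.+3 - 2) by rewrite divr_ge0// exprn_ge0.
have eta_r : merge_eta d c j.+3 <= d / 2 ^+ (j.+3 - 2) / 2.
  by rewrite etaE ler_wpM2r// ler_pdivrMr// ler_peMr.
have Fh u : u \in pk j.+3 q -> F (h u).
  move=> uP; apply: (@level_subF j.+3); first by have /andP[] := jJ.
  rewrite levelE//; apply/mapP; exists (q, h u) => //.
  by apply/h1; exists (q, u) => //; exact: cand.
split.
- exists h => u; apply/idP/idP.
    by move=> /offP[v vP ->]; exact: map_f.
  by move=> /mapP[v vP ->]; apply/offP; exists v.
- move=> u /[dup] uo /offP[v vP e]; split.
    move: uo; rewrite offspringE// [lev j.+3]levelE// => /mapP[p]; rewrite mem_filter.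
    by move=> /andP[_ pm] ->; exact: map_f.
  have [Fv qv] := Fpk v vP.
  have := dist2_triangle mu (bF Fq) (bF Fv) (bF (Fh v vP)).
  have := h2 (q, v) (cand v vP); rewrite -e /=; lra.
- move=> g Fg qg; have [v vP vg] := maximal_packing_cover maxp (conj qg Fg).
  exists (h v); first by apply/offP; exists v.
  have [Fv qv] := Fpk v vP.
  have := dist2_triangle mu (bF (Fh v vP)) (bF Fv) (bF Fg).
  have := h2 (q, v) (cand v vP); rewrite /= [dist2 mu v (h v)]dist2C.
  rewrite -/(merge_eta d c j.+3) in vg.
  have -> : d / (2 ^+ (j.+3 - 2) * c) = merge_eta d c j.+3 + merge_eta d c j.+3.
    by rewrite etaE; field; rewrite gt_eqF// gt_eqF// exprn_gt0.
  lra.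
Qed.

End Tree.

(** * Relations between the scales [tau_J], [delta_j] and the radii *)

Section Scales.
Context {R : realType}.
Variables (a b phi c d : R).
Hypotheses (a0 : 0 < a) (ab : a < b) (phi1 : 1 < phi) (phi2 : phi < 3 / 2).
Hypotheses (CL : 1 + Num.sqrt ((a * cab a b)^-1) < Cof c).

Local Notation L := (Lab a b (Cof c)).
Local Notation tau := (tauJ a b phi c d).

(** The range of [phi] places [1 / 2 - phi / 3] between 0 and [1 / 6]; [L / 24] is the rate in
    [bad_groups_outer]. *)
Lemma C10_bounds : 0 < C10 a b (Cof c) phi <= L / 24.
Proof.
have /andP[L0 _] := Lab_bounds a0 ab CL; have p1 := phi1; have p2 := phi2.
rewrite /C10; apply/andP; split; first by apply: mulr_gt0; [rewrite divr_gt0 | lra].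
rewrite (_ : L / 24 = L / 4 * 6^-1); last by field.
by apply: ler_wpM2l; [rewrite divr_ge0// ltW | lra].
Qed.

Lemma c_gt0 : 0 < c.
Proof.
have := CL; have := sqrtr_ge0 ((a * cab a b)^-1); rewrite /Cof; lra.
Qed.

Lemma tauJ_sqrE J : tau J ^+ 2 =
  C10 a b (Cof c) phi / (Cof c + 1) ^+ 2 * (d / 2 ^+ J.-1) ^+ 2.
Proof.
have /andP[C0 _] := C10_bounds; have c0 := c_gt0.
rewrite /tauJ -[in RHS](sqr_sqrtr (ltW C0)).
by field; rewrite expf_neq0//= gt_eqF// /Cof; lra.
Qed.

Lemma tauJ_sqr_delta J : (2 <= J)%N -> tau J ^+ 2 =
  C10 a b (Cof c) phi * (d / (2 ^+ (J - 2) * c)) ^+ 2.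
Proof.
case: J => [|[|J]]// _; have c0 := c_gt0.
rewrite tauJ_sqrE /= !subSS subn0 [2 ^+ J.+1]exprS /Cof subrK; field.
by rewrite gt_eqF// gt_eqF// exprn_gt0.
Qed.

Lemma tauJ_shift i J : (1 <= i <= J)%N -> tau i = 2 ^+ (J - i) * tau J.
Proof.
case: i J => [//|i] [//|J] /= iJ; have c0 := c_gt0.
have pJ : 2 ^+ J = 2 ^+ (J - i) * 2 ^+ i :> R by rewrite -exprD subnK.
rewrite /tauJ /= subSS pJ; field.
by rewrite !expf_neq0//= /Cof gt_eqF//; lra.
Qed.

(** The entropy in the definition of [Jb] is thus taken at the radius of the offspring balls, and
    dividing by [2 c] gives the packing scale of level [J]. *)
Lemma entropy_radiusE J : (2 <= J)%N ->
  tau J * c / Num.sqrt (C10 a b (Cof c) phi) = d / 2 ^+ (J - 2).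
Proof.
case: J => [|[|J]]// _; have c0 := c_gt0.
have /andP[C0 _] := C10_bounds.
rewrite /tauJ /= !subSS subn0 [2 ^+ J.+1]exprS /Cof subrK; field.
by rewrite ?gt_eqF// ?sqrtr_gt0// exprn_gt0.
Qed.

End Scales.

Lemma predn_subD i n : (1 <= i <= n)%N -> n.-1 = (n - i + i.-1)%N.
Proof. lia. Qed.

(** * Failure probability of each level and the risk bound *)

Section Risk.
Context {R : realType} {dT : measure_display} {T : measurableType dT}.
Variables (mu : probability T R) (a b phi c d : R) (F : set (T -> R)).
Hypotheses (a0 : 0 < a) (ab : a < b) (phi1 : 1 < phi) (phi2 : phi < 3 / 2).
Hypotheses (Cab : 16 * b / a <= Cof c)
  (CL : 1 + Num.sqrt ((a * cab a b)^-1) < Cof c) (c1 : 1 <= c).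
Hypothesis clF : forall g, F g -> in_class mu a b g.
Hypothesis starF : star_shaped F.
Hypothesis diamF : forall g h, F g -> F h -> dist2 mu g h <= d.
Hypothesis d0 : 0 <= d.

Context {dO : measure_display} {O : measurableType dO}.
Variables (P : probability O R) (f : T -> R) (N k : nat).
Variables (grp : 'I_N -> 'I_(N %/ k)) (Xt : 'I_N -> O -> T) (X : O -> 'I_N -> T).
Variables (root : T -> R) (pk : nat -> (T -> R) -> seq (T -> R)).
Variables (Jt Jb : nat) (nu : nat -> O -> (T -> R)).
Hypotheses (Ff : F f) (k0 : (0 < k)%N) (kN : (k %| N)%N).
Hypothesis grpk : forall j, #|[set i : 'I_N | grp i == j]%SET| = k.
Hypothesis mXt : forall i, measurable_fun setT (Xt i).
Hypothesis iidX : iid_density mu P Xt f.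
Hypothesis corrupt : forall w, exists S : {set 'I_N},
  #|S|%:R <= (3 * k%:R)^-1 * N%:R :> R /\ forall i, i \notin S -> X w i = Xt i w.
Hypotheses (Froot : F root) (tree : tree_ok mu F pk root d c Jt).
Hypothesis JbJt : (Jb <= Jt)%N.
Hypothesis nu1 : forall w, nu 1%N w = root.
Hypothesis nuS : forall j w, (2 <= j <= Jt)%N ->
  selected mu grp (Cof c) (d / (2 ^+ (j - 2) * c)) (X w)
    (offspring mu pk root d c j (nu j.-1 w)) (nu j w).

Local Notation lev := (level mu pk root d c).
Local Notation off := (offspring mu pk root d c).
Local Notation tau := (tauJ a b phi c d).

Let bF g (Fg : F g) : bounded_measurable g := in_class_bm a0 (clF Fg).

Lemma nu_level i w : (1 <= i <= Jt)%N -> nu i w \in lev i.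
Proof.
case: i => [//|i]; elim: i => [|i IH] iJ; first by rewrite nu1 mem_head.
have /IH ql : (1 <= i.+1 <= Jt)%N by have /andP[_ /ltnW] := iJ.
have [/inlP nuo _] := @nuS i.+2 w iJ.
have [_ H _] := offspringP bF diamF d0 c1 Froot tree (iJ : (2 <= i.+2 <= Jt)%N) ql.
exact: (H _ nuo).1.
Qed.

Lemma nu_F i w : (1 <= i <= Jt)%N -> F (nu i w).
Proof.
move=> iJ; apply: (level_subF d0 c1 Froot tree) (nu_level w iJ).
by have /andP[] := iJ.
Qed.

(** Telescoping: with [x = d / 2 ^ (i - 1)], the step from level [i] is at most
    [2 x = 4 x - 4 (x / 2)]. *)
Lemma nu_drift i n w : (1 <= i)%N -> (i + n <= Jt)%N ->
  dist2 mu (nu (i + n) w) (nu i w) <=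
    4 * (d / 2 ^+ i.-1) - 4 * (d / 2 ^+ (i + n).-1).
Proof.
case: i => [//|i] _; elim: n => [|n IH] inJ.
  by rewrite addn0 dist2xx subrr.
have inJ' : (i.+1 + n <= Jt)%N by move: inJ; rewrite addnS; exact: ltnW.
have F1 := @nu_F (i.+1 + n.+1) w inJ; have F2 := @nu_F (i.+1 + n) w inJ'.
have F3 : F (nu i.+1 w).
  by apply: nu_F; rewrite /= (leq_trans _ inJ')// leq_addr.
have step : dist2 mu (nu (i.+1 + n.+1) w) (nu (i.+1 + n) w) <= 2 * (d / 2 ^+ (i.+1 + n).-1).
  have rng : (2 <= i.+1 + n.+1 <= Jt)%N by rewrite inJ addnS.
  have prd : (i.+1 + n.+1).-1 = (i.+1 + n)%N by rewrite addnS.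
  have [/inlP] := @nuS _ w rng; rewrite prd => nuo _.
  have ql := @nu_level (i.+1 + n) w inJ'.
  rewrite -prd in ql.
  have [_ H _] := offspringP bF diamF d0 c1 Froot tree rng ql.
  rewrite prd in H; have [_] := H _ nuo.
  rewrite dist2C (_ : (i.+1 + n.+1 - 2)%N = (i.+1 + n).-1)//.
  by rewrite addnS addSn subSS subSS subn0.
have := dist2_triangle mu (bF F1) (bF F2) (bF F3).
have -> : d / 2 ^+ (i.+1 + n.+1).-1 = d / 2 ^+ (i.+1 + n).-1 / 2.
  by rewrite addnS addSn /= exprS; field; rewrite expf_neq0.
have {}IH := IH inJ'; lra.
Qed.

Hypothesis dpos : 0 < d.
Variable m : nat.
Hypothesis Jb2 : (2 <= Jb)%N.
Hypothesis entm : local_entropy mu F (tau Jb * c / Num.sqrt (C10 a b (Cof c) phi))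
  (2 * c) = (m%:R)%:E.
Hypothesis entN : 2 * ln (m%:R ^+ 2) < N%:R * tau Jb ^+ 2.
Hypothesis ln2N : ln 2 < N%:R * tau Jb ^+ 2.

Let c0 : 0 < c := c_gt0 CL.

(** Contracting by [2 ^ (Jb - j)] turns the packing into one at level [Jb], where [m] is the
    entropy. *)
Lemma packing_size_le j g Pk : (2 <= j <= Jb)%N -> F g ->
  is_packing mu (d / (2 ^+ j.-1 * c)) (F `&` ball2 mu g (d / 2 ^+ (j - 2))) Pk ->
  (size Pk <= m)%N.
Proof.
move=> /andP[j2 jJ] Fg pack.
have pow0 n : 0 < 2 ^+ n :> R by exact: exprn_gt0.
have cg := c0.
have t0 : 0 < (2 ^+ (Jb - j))^-1 :> R by rewrite invr_gt0.
have t1 : (2 ^+ (Jb - j))^-1 <= 1 :> R by rewrite invf_le1// exprn_ege1// ler1n.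
have t01 : (0 < (2 ^+ (Jb - j))^-1 :> R) && ((2 ^+ (Jb - j))^-1 <= 1 :> R).
  by rewrite t0 t1.
have [g' [Pk' [Fg' pack' <-]]] := packing_contract bF starF t01 Fg pack.
have e := entm; rewrite entropy_radiusE// in e.
apply: (local_entropy_packing e Fg').
move: pack'; congr is_packing.
  rewrite -(subnK jJ) addnK; case: j j2 {jJ pack t0 t1 t01} => [|[|j]] // _.
  rewrite !addnS !subSS subn0 /= exprD exprS; field.
  by rewrite !gt_eqF//.
congr (F `&` ball2 mu g' _).
rewrite -[in RHS](subnK jJ) -addnBA// exprD; field.
by rewrite !gt_eqF.
Qed.

(** The visited node is random, so the union bound runs over all nodes near [f] paired with all
    their offspring. There are at most [m ^ 2] pairs, and the entropy condition lets them consume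
    only half of the exponent. *)
Lemma stage_outer J j : (2 <= J <= Jb)%N -> (3 * k%:R)^-1 * 3 <= tau J ^+ 2 ->
  (2 <= j <= J)%N ->
  outer_bound P [set w | dist2 mu (nu j.-1 w) f <= d / 2 ^+ (j - 2) /\
                         d / 2 ^+ j.-1 < dist2 mu (nu j w) f]
    (expR (- (N%:R * tau j ^+ 2 / 2))).
Proof.
move=> /andP[J2 JJb] tauJ_ge /andP[j2 jJ].
have jJb : (j <= Jb)%N := leq_trans jJ JJb.
have jJt : (2 <= j <= Jt)%N by rewrite j2 (leq_trans jJb).
have j1Jt : (1 <= j.-1 <= Jt)%N.
  by move: jJt => /andP[]; case: (j) => [|[|i]] //= _ /ltnW.
have pow0 n : 0 < 2 ^+ n :> R by exact: exprn_gt0.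
have cg := c0; have dg := dpos.
have kR : 0 < k%:R :> R by rewrite ltr0n.
pose delta := d / (2 ^+ (j - 2) * c).
have delta0 : 0 < delta by rewrite divr_gt0// mulr_gt0.
have /andP[C0 C24] := C10_bounds a0 ab phi1 phi2 CL.
have tauE : tau j ^+ 2 = C10 a b (Cof c) phi * delta ^+ 2.
  exact: tauJ_sqr_delta.
have tau_le : forall i i', (1 <= i <= i')%N -> tau i' ^+ 2 <= tau i ^+ 2.
  move=> i i' ii'; rewrite (tauJ_shift phi d CL ii') [leRHS]exprMn ler_peMl ?sqr_ge0//.
  by rewrite -exprM exprn_ege1// ler1n.
have jpos : (1 <= j)%N by exact: ltnW.
have tau_J : tau J ^+ 2 <= tau j ^+ 2 by apply: tau_le; rewrite jpos.
have tau_Jb : tau Jb ^+ 2 <= tau j ^+ 2 by apply: tau_le; rewrite jpos.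
have C24d : tau j ^+ 2 <= Lab a b (Cof c) / 24 * delta ^+ 2.
  by rewrite tauE ler_wpM2r ?sqr_ge0.
(* The assumption on [tau J] reads [1 <= k * tau J ^ 2], and [tau j ^ 2] is at most
   [L delta ^ 2 / 24]. *)
have klarge : 24 <= k%:R * (Lab a b (Cof c) * delta ^+ 2).
  have h1 : 1 <= k%:R * tau j ^+ 2.
    apply: le_trans (ler_wpM2l (ltW kR) (le_trans tauJ_ge tau_J)).
    by rewrite [leRHS](_ : _ = 1)//; field; rewrite gt_eqF.
  have h2 := ler_wpM2l (ltW kR) C24d; lra.
have offE q (ql : q \in lev j.-1) := offspringP bF diamF d0 c1 Froot tree jJt ql.
pose Q := undup [seq q <- lev j.-1 | dist2 mu q f <= d / 2 ^+ (j - 2)].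
have QP q : q \in Q -> q \in lev j.-1 /\ dist2 mu q f <= d / 2 ^+ (j - 2).
  by rewrite mem_undup mem_filter => /andP[].
have FQ q : q \in Q -> F q.
  move=> /QP[ql _]; apply: (level_subF d0 c1 Froot tree) ql.
  by have /andP[] := j1Jt.
(* A reference offspring close to [f], fixed independently of the sample; the default [f] occurs
   only if no such offspring exists. *)
pose un q := xget f [set u | u \in off j q /\ dist2 mu u f <= delta].
have unP q : q \in Q -> un q \in off j q /\ dist2 mu (un q) f <= delta.
  move=> /QP[ql qf]; have [_ _ /(_ f Ff qf)[u uo uf]] := offE q ql.
  apply: (@xgetPex _ f [set u | u \in off j q /\ dist2 mu u f <= delta]).
  by exists u.
have Foff q u : q \in Q -> u \in off j q -> F u.
  move=> /QP[ql _] uo; have [_ /(_ u uo)[ul _] _] := offE q ql.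
  apply: (level_subF d0 c1 Froot tree) ul.
  by have /andP[] := jJt.
pose s := [seq (q, v) | q <- Q, v <- undup (off j q)].
pose E (p : (T -> R) * (T -> R)) :=
  [set w | Cof c * delta <= dist2 mu (un p.1) p.2 /\
           N%:R / (6 * k%:R) <= (#|bad_groups grp p.2 (un p.1) (Xt^~ w)|%:R : R)].
have bE p : p \in s -> outer_bound P (E p) (expR (- (N%:R * tau j ^+ 2))).
  move=> /allpairsPdep[q [v [qQ]]]; rewrite mem_undup => vo ->.
  have [far|near] := leP (Cof c * delta) (dist2 mu (un q) v); last first.
    apply: (outer_bound_le (expR_ge0 _)); apply: outer_bound_sub (outer_bound0 P).
    by move=> w [/= far]; rewrite ltNge far in near.
  have [uo uf] := unP q qQ.
  have := bad_groups_outer a0 ab mXt iidX k0 kN grpk (clF Ff) Cab CL delta0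
    (clF (Foff q _ qQ uo)) (clF (Foff q v qQ vo)) uf far klarge.
  move=> /(outer_bound_sub (_ : E (q, v) `<=` _)) H.
  apply: outer_bound_le (H _); last by move=> w [].
  by rewrite ler_expR lerN2 ler_wpM2l.
(* For [j >= 3] the separation of level [j - 1] is twice the packing scale of level [j]; for [j = 2]
   only the root is present. *)
have sizeQ : (size Q <= m)%N.
  apply: (@packing_size_le j f) => //; first by rewrite j2.
  apply: uniq_packing; first exact: undup_uniq.
    move=> q qQ; split; first exact: FQ.
    by have [_ qf] := QP q qQ; rewrite /ball2/= dist2C.
  move=> q q' /QP[ql _] /QP[ql' _].
  case: (j) j2 jJt ql ql' => [|[|[|i]]] // _ iJ.
    by rewrite /= !mem_seq1 => /eqP q1 /eqP q2; left; rewrite q1 q2.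
  have iJ' : (2 <= i.+2 <= Jt)%N by have /andP[_ /ltnW] := iJ.
  move=> ql ql'; have [->|h] := level_sep d0 c1 tree iJ' ql ql'; first by left.
  right; apply: le_lt_trans h; rewrite /merge_eta /=.
  have p1 := mulr_gt0 (pow0 i.+1) cg; have p2 := mulr_gt0 (pow0 i.+2) cg.
  by rewrite ler_pM2l// lef_pV2 ?posrE// [2 ^+ i.+2]exprS; lra.
have sizeoff q : q \in Q -> (size (undup (off j q)) <= m)%N.
  move=> qQ; have [ql _] := QP q qQ; have [[h hE] _ _] := offE q ql.
  apply: (@leq_trans (size (pk j q))).
    rewrite -(size_map h); apply: uniq_leq_size; first exact: undup_uniq.
    by move=> u; rewrite mem_undup hE.
  apply: (@packing_size_le j q); [by rewrite j2|exact: FQ|].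
  case: (j) j2 jJt ql => [|[|[|i]]] // _ iJ ql.
    have [[[H1 H2] _] _] := tree.
    have /eqP -> : q == root by move: ql; rewrite inE.
    split=> [u /H1 Fu|i i' iP i'P ii'].
      by split => //; rewrite /ball2/= subnn expr0 divr1 diamF.
    apply: le_lt_trans (H2 _ _ iP i'P ii'); rewrite /= expr1.
    by rewrite ler_pM2l// lef_pV2 ?posrE ?mulr_gt0//; lra.
  have [_ /(_ i.+3 iJ q ((inlP _ _).2 ql))[pack _]] := tree.
  by rewrite setIC.
have sizes : (size s <= m * m)%N.
  rewrite /s size_allpairs_dep; apply: (@leq_trans (size Q * m)); last first.
    by rewrite leq_mul2r sizeQ orbT.
  elim: (Q) sizeoff => [//|q l IH] H; rewrite /= mulSn leq_add ?H ?mem_head//.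
  by apply: IH => q' q'l; apply: H; rewrite inE q'l orbT.
have mle : m%:R * m%:R <= expR (N%:R * tau j ^+ 2 / 2).
  case: (posnP m) => [->|m0]; first by rewrite mul0r expR_ge0.
  have mm0 : 0 < m%:R ^+ 2 :> R by rewrite exprn_gt0// ltr0n.
  rewrite -expr2 -[leLHS]lnK ?posrE// ler_expR.
  have := ler_wpM2l (ler0n R N) tau_Jb; have := entN; lra.
apply: outer_bound_le (outer_bound_sub _ (outer_bound_bigcup_cst bE)).
  apply: (@le_trans _ _ (expR (N%:R * tau j ^+ 2 / 2) * expR (- (N%:R * tau j ^+ 2)))).
    rewrite ler_wpM2r ?expR_ge0//; apply: le_trans mle.
    by rewrite -natrM ler_nat.
  by rewrite -expRD ler_expR; lra.
move=> w [qf far]; apply: contrapT => noE; move: far; apply/negP; rewrite -leNgt.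
have ql := nu_level w j1Jt.
have qQ : nu j.-1 w \in Q by rewrite mem_undup mem_filter qf.
have [uo uf] := unP _ qQ.
have [S [cS XS]] := corrupt w.
have pos g : F g -> forall x, 0 < g x.
  by move=> /clF[_ gab _] x; have /andP[ag _] := gab x; exact: lt_le_trans ag.
have CC : 0 < Cof c * delta.
  have := CL; have := sqrtr_ge0 ((a * cab a b)^-1) => h1 h2.
  by rewrite mulr_gt0//; lra.
(* The choice [C + 1 = c / 2] makes the error after selection exactly the next radius. *)
have Cdelta : Cof c * delta + delta = d / 2 ^+ j.-1.
  rewrite /delta /Cof; case: (j) j2 => [|[|i]] // _; rewrite !subSS subn0 /= exprS.
  by field; rewrite !gt_eqF.
have near := selected_near CC uo _ (nuS w jJt).
have Fnu : F (nu j w) by apply: nu_F; case/andP: jJt => _ ->; rewrite jpos.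
have {}near : dist2 mu (un (nu j.-1 w)) (nu j w) < Cof c * delta.
  apply: near => v vo far.
  apply: (psi_of_few_bad_groups k0 kN (pos _ (Foff _ _ qQ uo)) (pos _ (Foff _ _ qQ vo)) cS XS).
  rewrite ltNge; apply/negP => bad; apply: noE.
  exists (nu j.-1 w, v) => //.
  by apply/allpairsPdep; exists (nu j.-1 w), v; rewrite mem_undup.
have := dist2_triangle mu (bF Fnu) (bF (Foff _ _ qQ uo)) (bF Ff).
by rewrite [dist2 mu (nu j w) (un _)]dist2C; lra.
Qed.

(** [4 / 3] is the fixed point of the recursion [x -> 1 + x / 4]. *)
Lemma geometric_sum_le n : \sum_(2 <= j < n.+1) (4^-1 : R) ^+ (n - j) <= 4 / 3.
Proof.
elim: n => [|n IH]; first by rewrite big_geq// divr_ge0.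
have [n1|n2] := leqP n.+1 1; first by rewrite big_geq// divr_ge0.
rewrite big_nat_recr//= subnn expr0.
have -> : \sum_(2 <= i < n.+1) (4^-1 : R) ^+ (n.+1 - i) =
    4^-1 * \sum_(2 <= i < n.+1) 4^-1 ^+ (n - i).
  rewrite mulr_sumr; apply: eq_big_nat => i /andP[_ iN].
  by rewrite -exprS subSn.
lra.
Qed.

Lemma risk_le J : (2 <= J <= Jb)%N -> (3 * k%:R)^-1 * 3 <= tau J ^+ 2 ->
  (\int[P]_w ((dist2 mu (nu Jt w) f) ^+ 2)%:E <=
    (70 ^+ 2 * (d / 2 ^+ J.-1) ^+ 2)%:E)%E.
Proof.
move=> JJ tauJ_ge; have /andP[J2 JJb] := JJ.
have dg := dpos.
have pow0 n : 0 < 2 ^+ n :> R by exact: exprn_gt0.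
have JJt : (J <= Jt)%N := leq_trans JJb JbJt.
have /choice[B BP] : forall j, exists B : set O, (2 <= j <= J)%N ->
    [/\ measurable B, [set w | dist2 mu (nu j.-1 w) f <= d / 2 ^+ (j - 2) /\
          d / 2 ^+ j.-1 < dist2 mu (nu j w) f] `<=` B &
        (P B <= (expR (- (N%:R * tau j ^+ 2 / 2)))%:E)%E].
  move=> j; have [jJ|] := boolP (2 <= j <= J)%N; last by exists set0.
  by have [B BP] := stage_outer JJ tauJ_ge jJ; exists B.
pose r := d / 2 ^+ J.-1.
(* Error at level [i] plus at most four times that radius of later drift: [25 = (1 + 4) ^ 2]. *)
have final i w : (1 <= i <= J)%N -> dist2 mu (nu i w) f <= d / 2 ^+ i.-1 ->
    dist2 mu (nu Jt w) f ^+ 2 <= 25 * (d / 2 ^+ i.-1) ^+ 2.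
  move=> /andP[i1 iJ] near.
  have iJt : (i <= Jt)%N := leq_trans iJ JJt.
  have Fi : F (nu i w) by apply: nu_F; rewrite i1.
  have FJt : F (nu Jt w) by apply: nu_F; rewrite (leq_trans i1 iJt) leqnn.
  have := @nu_drift i (Jt - i) w i1; rewrite subnKC// => /(_ (leqnn _)) drift.
  have tri := dist2_triangle mu (bF FJt) (bF Fi) (bF Ff).
  have e0 : 0 < d / 2 ^+ Jt.-1 by rewrite divr_gt0.
  have ri : 0 < d / 2 ^+ i.-1 by rewrite divr_gt0.
  have : dist2 mu (nu Jt w) f <= 5 * (d / 2 ^+ i.-1) by lra.
  move=> h; rewrite (_ : 25 = 5 ^+ 2); last by ring.
  by rewrite -exprMn lerXn2r ?nnegrE ?dist2_ge0// mulr_ge0// ltW.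
(* If level [j] is the first to lose [f], level [j - 1] still had twice the radius, whence
   [100 = 25 * 4]. *)
pose coef j := 100 * (d / 2 ^+ j.-1) ^+ 2.
have coef0 j : 0 <= coef j by rewrite mulr_ge0 ?sqr_ge0.
pose BJ j := if (2 <= j <= J)%N then B j else set0.
have mBJ j : measurable (BJ j).
  by rewrite /BJ; case: ifP => // /BP[].
pose H w := 25 * r ^+ 2 + \sum_(2 <= j < J.+1) coef j * \1_(BJ j) w.
have term0 w j : 0 <= coef j * \1_(BJ j) w by rewrite mulr_ge0.
have pointwise w : dist2 mu (nu Jt w) f ^+ 2 <= H w.
  have sum0 : 0 <= \sum_(2 <= j < J.+1) coef j * \1_(BJ j) w by apply: sumr_ge0.
  (* Induction along the path: either [f] has not been lost so far, or the term of the first loss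
     already bounds the error. *)
  have : forall i, (1 <= i <= J)%N -> dist2 mu (nu i w) f <= d / 2 ^+ i.-1 \/
      dist2 mu (nu Jt w) f ^+ 2 <= H w.
    case=> [//|]; elim=> [_|i IH iJ].
      by left; rewrite /= expr0 divr1 nu1; exact: diamF.
    have i1J : (1 <= i.+1 <= J)%N by have /andP[_ /ltnW] := iJ.
    have [near|] := IH i1J; last by right.
    have [//|far] := leP (dist2 mu (nu i.+2 w) f) (d / 2 ^+ i.+2.-1); first by left.
    right; apply: le_trans (final i.+1 w i1J near) _.
    have iJ2 : (2 <= i.+2 <= J)%N := iJ.
    have Bw : BJ i.+2 w.
      rewrite /BJ iJ2; have [_ sub _] := BP _ iJ2; apply: sub; split => //.
      by rewrite !subSS subn0.
    rewrite /H (bigD1_seq i.+2) ?iota_uniq//=; last by rewrite mem_index_iota ltnS.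
    rewrite indicE mem_set// mulr1.
    have -> : 25 * (d / 2 ^+ i) ^+ 2 = coef i.+2.
      rewrite /coef /= [2 ^+ i.+1]exprS; field.
      by rewrite expf_neq0.
    have : 0 <= \sum_(2 <= j < J.+1 | j != i.+2) coef j * \1_(BJ j) w by apply: sumr_ge0.
    have := sqr_ge0 r; lra.
  move=> /(_ J); rewrite (ltnW J2) leqnn => /(_ isT)[near|//].
  apply: le_trans (final J w _ near) _; first by rewrite (ltnW J2) leqnn.
  by rewrite /H lerDl.
have bH : bounded_measurable H.
  apply: bmD; first exact: bm_cst.
  by apply: bm_sum => j; apply: bmM; [exact: bm_cst|exact: bm_indic].
apply: (@le_trans _ _ (\int[P]_w (H w)%:E)%E).
  by apply: le_integral_nonmeasurable => w; rewrite lee_fin// sqr_ge0.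
rewrite integral_bm// lee_fin RintegralD_bm; [|exact: bm_cst|]; last first.
  by apply: bm_sum => j; apply: bmM; [exact: bm_cst|exact: bm_indic].
rewrite Rintegral_cst_prob Rintegral_sum_bm; last first.
  by move=> j; apply: bmM; [exact: bm_cst|exact: bm_indic].
have Jpos : (1 <= J)%N by exact: ltnW.
have Y0 : 1 / 2 <= N%:R * tau J ^+ 2.
  have l2 : 1 / 2 <= ln 2 :> R.
    have := @ln_le_subr1 R 2^-1; rewrite lnV ?posrE// => /(_ _); lra.
  have : tau Jb ^+ 2 <= tau J ^+ 2.
    have JJ1 : (1 <= J <= Jb)%N by rewrite Jpos.
    rewrite (tauJ_shift phi d CL JJ1) [leRHS]exprMn ler_peMl ?sqr_ge0//.
    by rewrite -exprM exprn_ege1// ler1n.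
  move=> /(ler_wpM2l (ler0n R N)); have := ln2N; lra.
apply: (@le_trans _ _ (25 * r ^+ 2 + \sum_(2 <= j < J.+1) 100 * 32 * r ^+ 2 * 4^-1 ^+ (J - j))).
  rewrite lerD2l !big_nat; apply: ler_sum => j jJ.
  rewrite RintegralZ_bm; last exact: bm_indic.
  have jJ1 : (1 <= j <= J)%N by have /andP[/ltnW -> ] := jJ; rewrite ltnS.
  have [_ _ PB] := BP j jJ.
  have -> : \int[P]_w \1_(BJ j) w = fine (P (B j)).
    rewrite /Rintegral integral_indic// setIT /BJ.
    by rewrite ltnS in jJ; rewrite jJ.
  have PB' : fine (P (B j)) <= expR (- (N%:R * tau j ^+ 2 / 2)).
    by rewrite -lee_fin fineK// fin_num_measure//; have [] := BP j jJ.
  set q := 4 ^+ (J - j) : R.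
  have q0 : 0 < q by exact: exprn_gt0.
  have pE : 2 ^+ (J - j) ^+ 2 = q by rewrite /q -exprM mulnC exprM; congr (_ ^+ _); ring.
  have coefE : coef j = 100 * q * r ^+ 2.
    rewrite /coef /r -pE.
    have -> : d / 2 ^+ j.-1 = 2 ^+ (J - j) * (d / 2 ^+ J.-1).
      have -> : 2 ^+ J.-1 = 2 ^+ (J - j) * 2 ^+ j.-1 :> R.
        by rewrite -exprD -predn_subD.
      by field; rewrite !expf_neq0.
    by ring.
  have yE : N%:R * tau j ^+ 2 = q * (N%:R * tau J ^+ 2).
    by rewrite (tauJ_shift phi d CL jJ1) [X in _ * X = _]exprMn pE; ring.
  (* From [1 + x ^ 2 / 2 <= expR x] at [x = y / 2 >= q / 4]. The square of [q] beats the factor [q]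
     in [coef j] and leaves a geometric series. *)
  have expb : expR (- (N%:R * tau j ^+ 2 / 2)) <= 32 / q ^+ 2.
    rewrite expRN -[leRHS]invrK lef_pV2 ?posrE ?expR_gt0 ?invr_gt0 ?divr_gt0 ?exprn_gt0//.
    set y := N%:R * tau j ^+ 2.
    have y1 : q / 2 <= y by rewrite /y yE; nra.
    have y0 : 0 <= y / 2 by lra.
    have := expR_ge1Dxn 1 y0; rewrite (_ : 2`! = 2)%N//.
    have -> : (32 / q ^+ 2)^-1 = q ^+ 2 / 32 by rewrite invf_div.
    nra.
  apply: (@le_trans _ _ (coef j * (32 / q ^+ 2))).
    by rewrite ler_wpM2l// (le_trans PB').
  rewrite coefE exprVn -/q le_eqVlt; apply/orP; left; apply/eqP; field.
  by rewrite gt_eqF.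
rewrite -mulr_sumr.
(* Numerically, [25 + 3200 * 4 / 3 <= 70 ^ 2]. *)
rewrite -/r; have r2 := sqr_ge0 r; have := ler_wpM2l r2 (geometric_sum_le J).
by set S := \sum_(2 <= j < J.+1) _; lra.
Qed.

End Risk.

(** * Choice of constants and conclusion *)

(** Values in [[a, b]] differ by at most [b - a], so the set of distances is bounded and its [sup]
    is a genuine supremum. *)
Lemma dist2_le_diameter (R : realType) (dT : measure_display)
    (T : measurableType dT) (mu : probability T R) (a b : R) (F : set (T -> R))
    (g h : T -> R) : 0 < a -> a < b ->
  (forall u, F u -> in_class mu a b u) ->
  F g -> F h -> dist2 mu g h <= diameter mu F.
Proof.
move=> a0 ab clF Fg Fh; apply: ub_le_sup; last by exists g => //; exists h.
exists (b - a) => _ [u Fu [v Fv <-]].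
have cu := clF u Fu; have cv := clF v Fv.
apply: dist2_le_cst; [exact: in_class_bm cu|exact: in_class_bm cv|lra|].
case: cu cv => _ uab _ [_ vab _] x.
have /andP[ua ub] := uab x; have /andP[va vb] := vab x.
by rewrite ler_norml; lra.
Qed.

Theorem mainTheorem4 (R : realType) (dT : measure_display) (T : measurableType dT)
  (mu : probability T R) (alpha beta phi : R) (F : set (T -> R)) (d : R) :
  0 < alpha -> alpha < beta -> 1 < phi -> phi < 3 / 2 ->
  (forall g, F g -> in_class mu alpha beta g) ->
  star_shaped F ->
  d = diameter mu F ->
  exists c0 : R, forall c : R, c0 <= c ->
  exists K : R, 0 < K /\
  forall (dO : measure_display) (O : measurableType dO) (P : probability O R)
    (f : T -> R) (N k : nat) (eps : R) (grp : 'I_N -> 'I_(N %/ k))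
    (Xt : 'I_N -> O -> T) (X : O -> 'I_N -> T)
    (root : T -> R) (pk : nat -> (T -> R) -> seq (T -> R))
    (Jt Jb : nat) (nu : nat -> O -> (T -> R)),
    F f ->
    (0 < N)%N -> (0 < k)%N -> (k %| N)%N -> eps = (3 * k%:R)^-1 ->
    (forall j, #|[set i : 'I_N | grp i == j]%SET| = k) ->
    (forall i, measurable_fun setT (Xt i)) ->
    iid_density mu P Xt f ->
    (forall i, measurable_fun setT (fun w => X w i)) ->
    (forall w, exists S : {set 'I_N},
        #|S|%:R <= eps * N%:R /\ forall i, i \notin S -> X w i = Xt i w) ->
    F root ->
    tree_ok mu F pk root d c Jt ->
    is_Jbar mu F alpha beta phi c d N Jb ->
    (Jb <= Jt)%N ->
    (forall w, nu 1%N w = root) ->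
    (forall j w, (2 <= j <= Jt)%N ->
       selected mu grp (Cof c) (d / (2 ^+ (j - 2) * c)) (X w)
         (offspring mu pk root d c j (nu j.-1 w)) (nu j w)) ->
    (\int[P]_w (((dist2 mu (nu Jt w) f) ^+ 2)%:E)
      <= (K * Num.min (Num.max (tauJ alpha beta phi c d Jb ^+ 2) eps) (d ^+ 2))%:E)%E.
Proof.
move=> a0 ab phi1 phi2 clF starF dE.
pose sq := Num.sqrt ((alpha * cab alpha beta)^-1).
(* This gives [Cof c >= 2 + 16 beta / alpha + sq], above both lower bounds required of [C]. *)
exists (2 * (3 + 16 * beta / alpha + sq)) => c cge.
have sq0 : 0 <= sq by exact: sqrtr_ge0.
have ba0 : 0 < 16 * beta / alpha by rewrite divr_gt0//; lra.
have Cab : 16 * beta / alpha <= Cof c by rewrite /Cof; lra.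
have CL : 1 + sq < Cof c by rewrite /Cof; lra.
have c1 : 1 <= c by lra.
have /andP[C0 _] := C10_bounds a0 ab phi1 phi2 CL.
pose kappa := C10 alpha beta (Cof c) phi / (Cof c + 1) ^+ 2.
have kappa0 : 0 < kappa by rewrite divr_gt0// exprn_gt0// /Cof; lra.
have diamF g h : F g -> F h -> dist2 mu g h <= d.
  by rewrite dE; exact: dist2_le_diameter clF.
(* [70 ^ 2 / kappa] expresses the risk bound through [tau J ^ 2]; 12 is 4 for one level times 3 from
   [3 eps]; the added 1 accommodates the bound by [d ^ 2]. *)
exists (12 * (70 ^+ 2 / kappa) + 1).
have K0 : 0 < 12 * (70 ^+ 2 / kappa) by rewrite mulr_gt0// divr_gt0// exprn_gt0.
split; first lra.
move=> dO O P f N k eps grp Xt X root pk Jt Jb nu.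
move=> Ff N0 k0 kN epsE grpk mXt iidX mX corrupt Froot tree [Jb1 jbar] JbJt nu1 nuS.
subst eps; set eps := (3 * k%:R)^-1.
have d0 : 0 <= d by apply: le_trans (diamF f f Ff Ff); exact: dist2_ge0.
have eps0 : 0 < eps by rewrite invr_gt0 mulr_gt0// ltr0n.
pose tau := tauJ alpha beta phi c d.
have tauE J : tau J ^+ 2 = kappa * (d / 2 ^+ J.-1) ^+ 2 by exact: tauJ_sqrE.
have Fnu w : F (nu Jt w).
  by apply: (nu_F a0 c1 clF diamF d0 Froot tree nu1 nuS) => //; rewrite (leq_trans Jb1 JbJt) leqnn.
set I := (\int[P]_w _)%E.
have le_d : (I <= (d ^+ 2)%:E)%E.
  apply: (@le_trans _ _ (\int[P]_w (d ^+ 2)%:E)%E).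
    apply: le_integral_nonmeasurable => w; rewrite lee_fin ?sqr_ge0//.
    by rewrite lerXn2r ?nnegrE ?dist2_ge0// diamF.
  by rewrite (integral_bm P (bm_cst (d ^+ 2))) Rintegral_cst_prob.
have le_tau1 : (I <= (70 ^+ 2 / kappa * tau 1%N ^+ 2)%:E)%E.
  apply: le_trans le_d _; rewrite lee_fin tauE /= expr0 divr1 mulrA divfK ?gt_eqF//.
  by rewrite ler_peMl ?sqr_ge0//; lra.
have main : (I <= (12 * (70 ^+ 2 / kappa) * Num.max (tau Jb ^+ 2) eps)%:E)%E.
  have le_of_tau J : (I <= (70 ^+ 2 / kappa * tau J ^+ 2)%:E)%E ->
      tau J ^+ 2 <= 12 * Num.max (tau Jb ^+ 2) eps ->
      (I <= (12 * (70 ^+ 2 / kappa) * Num.max (tau Jb ^+ 2) eps)%:E)%E.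
    move=> h1 h2; apply: le_trans h1 _; rewrite lee_fin.
    have -> : 12 * (70 ^+ 2 / kappa) * Num.max (tau Jb ^+ 2) eps =
      70 ^+ 2 / kappa * (12 * Num.max (tau Jb ^+ 2) eps) by field; rewrite gt_eqF.
    by apply: ler_wpM2l => //; rewrite divr_ge0 ?sqr_ge0// ltW.
  have max_ge : tau Jb ^+ 2 <= 12 * Num.max (tau Jb ^+ 2) eps.
    have h1 : tau Jb ^+ 2 <= Num.max (tau Jb ^+ 2) eps by rewrite le_max lexx.
    by have := sqr_ge0 (tau Jb); lra.
  have [Jb_le1|Jb2] := leqP Jb 1%N.
    have Jb_1 : Jb = 1%N by apply/eqP; rewrite eqn_leq Jb_le1.
    by apply: (le_of_tau 1%N) => //; rewrite Jb_1 in max_ge *.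
  case: jbar => [[[m [entm]]]|[_ e]]; last by rewrite e in Jb2.
  rewrite gt_max => /andP[entN ln2N] _.
  have [d_le0|dpos] := leP d 0.
    have d_0 : d = 0 by apply/eqP; rewrite eq_le d_le0.
    apply: le_trans le_d _; rewrite d_0 expr0n lee_fin mulr_ge0 ?ltW//.
    by rewrite lt_max eps0 orbT.
  pose good J := ((1 <= J <= Jb)%N && ((J == 1%N) || (eps * 3 <= tau J ^+ 2))).
  have ex_good : exists J, good J by exists 1%N; rewrite /good Jb1.
  have ub_good J : good J -> (J <= Jb)%N by move=> /andP[/andP[]].
  have [J /andP[/andP[J1 JJb] gJ] maxJ] := ex_maxnP ex_good ub_good.
  apply: (le_of_tau J).
    have [->//|J_1] := eqVneq J 1%N; rewrite (negbTE J_1)/= in gJ.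
    have J2 : (2 <= J)%N by rewrite ltn_neqAle eq_sym J_1.
    rewrite tauE mulrA divfK ?gt_eqF//.
    by apply: (risk_le a0 ab phi1 phi2 Cab CL c1 clF starF diamF d0 Ff k0 kN grpk
      mXt iidX corrupt Froot tree JbJt nu1 nuS dpos Jb2 entm entN ln2N) => //; rewrite J2.
  have [JJb'|JJb'] := leqP Jb J; first by have -> : J = Jb by apply/eqP; rewrite eqn_leq JJb.
  have small : tau J.+1 ^+ 2 < eps * 3.
    rewrite ltNge; apply/negP => h; have /maxJ : good J.+1 by rewrite /good JJb' h orbT.
    by rewrite ltnn.
  have -> : tau J ^+ 2 = 4 * tau J.+1 ^+ 2.
    rewrite !tauE; case: J J1 {JJb gJ maxJ JJb' small} => [//|J] _.
    by rewrite /= [2 ^+ J.+1]exprS; field; rewrite expf_neq0.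
  have : eps <= Num.max (tau Jb ^+ 2) eps by rewrite le_max lexx orbT.
  lra.
have KK : (12 * (70 ^+ 2 / kappa) * Num.max (tau Jb ^+ 2) eps) <=
  (12 * (70 ^+ 2 / kappa) + 1) * Num.max (tau Jb ^+ 2) eps.
  by rewrite ler_wpM2r ?le_max ?(ltW eps0) ?orbT//; lra.
rewrite minEle; case: ifP => _.
  by apply: le_trans main _; rewrite lee_fin.
by apply: le_trans le_d _; rewrite lee_fin ler_peMl ?sqr_ge0//; lra.
Qed.
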